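(* Let $k$ be a field and let $\Sigma_0\to\Sigma_1\to\cdots\to\Sigma_n$ be a filtration of finite simplicial complexes, i.e. a functor $\Sigma\colon[n]\to\mathbf{SimpComp}$ with $\Sigma_i=\Sigma(i)$. Let $\mathcal{I}\colon[n]^{\mathrm{op}}\to\mathbf{Alg}_k$ be the diagram with $\mathcal{I}(i)=I(\Sigma_i)$ and, for $i\leq j$, the restriction map $I(\Sigma_j)\to I(\Sigma_i)$. Then \[\mathrm{HH}^q_{\mathrm{GS}}(\mathcal{I},\mathcal{I})\cong \mathrm{H}^q(\Sigma_n;k)\] for all $q\geq 0$, where the right side is simplicial cohomology.
   Context: $[n]$ is the category with objects $0,\dots,n$ and a unique morphism $i\to j$ iff $i\le j$. $\mathbf{SimpComp}$ is the category of finite simplicial complexes and injective simplicial maps. For a finite simplicial complex $\Sigma$, its face poset $F(\Sigma)$ is the set of simplices ordered by inclusion, and $I(\Sigma)$ is the incidence algebra of $F(\Sigma)$: the $k$-vector space with basis the pairs $x\le y$ in $F(\Sigma)$ (morphisms of the poset viewed as a category), with product of basis elements equal to their composite when composable and $0$ otherwise. An injective simplicial map $\Sigma_i\to\Sigma_j$ identifies $F(\Sigma_i)$ with a lower ideal of $F(\Sigma_j)$; the restriction map $I(\Sigma_j)\to I(\Sigma_i)$ sends a basis element $x\le y$ to the corresponding basis element if $x,y$ lie in the image of $F(\Sigma_i)$, and to $0$ otherwise. Diagrammatic Hochschild cohomology of a presheaf of algebras $\mathcal{A}\colon\mathbf C^{\mathrm{op}}\to\mathbf{Alg}_k$ with coefficients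 in itself: the cohomology of the total complex of the double complex $C^{p,q}=\prod_\sigma\mathrm{Hom}_k(\mathcal{A}(c_p)^{\otimes q},\mathcal{A}(c_0))$ over strings $\sigma=(c_0\to\cdots\to c_p)$ of composable morphisms, with Hochschild differential in $q$ and simplicial differential $(d\Gamma)^\sigma=\mathcal{A}(c_0\to c_1)\circ\Gamma^{\partial_0\sigma}+\sum_{r=1}^{p-1}(-1)^r\Gamma^{\partial_r\sigma}+(-1)^p\Gamma^{\partial_p\sigma}\circ\mathcal{A}(c_{p-1}\to c_p)^{\otimes q}$ in $p$ ($\partial_r$ deletes $c_r$). *)

(* Defs.v *)
From HB Require Import structures.
From mathcomp Require Import all_boot all_order all_algebra.
Set Implicit Arguments. Unset Strict Implicit. Unset Printing Implicit Defensive.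
Import GRing.Theory.
Local Open Scope ring_scope.

Definition is_simpcomp (N : nat) (S : {set {set 'I_N}}) : Prop :=
  set0 \notin S /\
  (forall s t : {set 'I_N}, s \in S -> t \subset s -> t != set0 -> t \in S).

Definition verts (N : nat) (S : {set {set 'I_N}}) : {set 'I_N} :=
  \bigcup_(s in S) s.

Definition inj_simp_map (N : nat) (S T : {set {set 'I_N}}) (f : 'I_N -> 'I_N)
  : Prop :=
  (forall s, s \in S -> f @: s \in T) /\ {in verts S &, injective f}.

Section Filtration.
Variable k : fieldType.
Variable N : nat.
Variable n : nat.
(* the filtration Sigma_0 -> ... -> Sigma_n : complexes S i and the maps *)
(* f i : Sigma_i -> Sigma_(i+1); only i <= n (resp. i < n) matter.       *)
Variable S : nat -> {set {set 'I_N}}.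
Variable f : nat -> 'I_N -> 'I_N.

Fixpoint fcomp (i d : nat) : 'I_N -> 'I_N :=
  if d is d'.+1 then f (i + d') \o fcomp i d' else id.
Definition fmap (i j : nat) : 'I_N -> 'I_N := fcomp i (j - i).

(* pairs of vertex sets; the basis of I(Sigma_i) is the set of pairs x <= y *)
(* of faces of Sigma_i                                                     *)
Local Notation PT := ({set 'I_N} * {set 'I_N})%type.
Definition defP : PT := (set0, set0).
Definition Bas (i : nat) : {set PT} :=
  [set u : PT | [&& u.1 \in S i, u.2 \in S i & u.1 \subset u.2]].

(* elements of the incidence algebra I(Sigma_i): coefficient functions on *)
(* pairs, supported on Bas i                                              *)
Local Notation Alg := {ffun PT -> k^o}.
Definition evec (u : PT) : Alg := [ffun w => (w == u)%:R].
(* product: e_(x<=y) * e_(y<=z) = e_(x<=z), and 0 if not composable *)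
Definition amul (a b : Alg) : Alg :=
  [ffun w : PT => \sum_(y : {set 'I_N}) a (w.1, y) * b (y, w.2)].
Definition res (i j : nat) (a : Alg) : Alg :=
  [ffun w : PT => if w \in Bas i then a (fmap i j @: w.1, fmap i j @: w.2)
                  else 0].

(* The total complex of the Gerstenhaber-Schack double complex.        *)
(* An element of C^{p,q} = prod_sigma Hom(I(c_p)^{(x)q}, I(c_0)) is    *)
(* determined by its values on q-tuples of basis elements, i.e. by     *)
(* coefficients Gamma(p, sigma, t, b) (t a q-tuple of basis pairs of   *)
(* I(c_p), b a basis pair of I(c_0)).  In total degree m these are     *)
(* indexed by J m (strings and tuples padded to length m+1 canonically) *)
Definition J (m : nat) :=
  ('I_m.+1 * {ffun 'I_m.+1 -> 'I_n.+1} * {ffun 'I_m.+1 -> PT} * PT)%type.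

Definition validJ (m : nat) (j : J m) : bool :=
  let p := j.1.1.1 in let sg := j.1.1.2 in let t := j.1.2 in let b := j.2 in
  [forall i : 'I_m.+1,
     ((p < i)%N ==> (sg i == ord0)) && ((i < p)%N ==> (sg i <= sg (inord i.+1))%N)]
  && [forall i : 'I_m.+1,
        if (i < m - p)%N then t i \in Bas (sg p) else t i == defP]
  && (b \in Bas (sg ord0)).

Definition Cspace (m : nat) : {vspace {ffun J m -> k^o}} :=
  <<[seq [ffun x : J m => ((x == j)%:R : k^o)] | j <- enum (@validJ m)]>>%VS.

Definition getC (m : nat) (G : {ffun J m -> k^o}) (p : nat)
  (sg : nat -> 'I_n.+1) (t : {ffun 'I_m.+1 -> PT}) (b : PT) : k :=
  let j : J m :=
    (inord p, [ffun i : 'I_m.+1 => if (i <= p)%N then sg i else ord0], t, b) in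
  if validJ j then G j else 0.

(* Gamma^sigma(a_1, ..., a_q) for the (p, sigma)-component, q = m - p,  *)
(* extended multilinearly from basis tuples                             *)
Definition ev (m : nat) (G : {ffun J m -> k^o}) (p : nat)
  (sg : nat -> 'I_n.+1) (a : nat -> Alg) : Alg :=
  [ffun b : PT =>
     \sum_(t : {ffun 'I_m.+1 -> PT} |
             [forall i : 'I_m.+1, (m - p <= i)%N ==> (t i == defP)])
       (\prod_(i < m.+1 | (i < m - p)%N) a i (t i)) * getC G p sg t b].

Definition Dtot (m : nat) (G : {ffun J m -> k^o}) : {ffun J m.+1 -> k^o} :=
  [ffun j : J m.+1 =>
    let p : nat := j.1.1.1 in
    let q : nat := (m.+1 - p)%N in
    let sg := fun l : nat => j.1.1.2 (inord l) in
    let c := fun l : nat => (sg l : nat) in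
    let a := fun l : nat => evec (j.1.2 (inord l)) in
    let simp : Alg :=
      if p is p0.+1 then
        res (c 0%N) (c 1%N) (ev G p0 (fun l => sg l.+1) a)
        + \sum_(1 <= r < p) (-1) ^+ r *:
            ev G p0 (fun l => if (l < r)%N then sg l else sg l.+1) a
        + (-1) ^+ p *: ev G p0 sg (fun l => res (c p0) (c p) (a l))
      else 0 in
    let hoch : Alg :=
      if q is q0.+1 then
        let phi := res (c 0%N) (c p) in
        amul (phi (a 0%N)) (ev G p sg (fun l => a l.+1))
        + \sum_(1 <= i < q) (-1) ^+ i *:
            ev G p sg (fun l => if (l < i.-1)%N then a l
                                else if l == i.-1 then amul (a i.-1) (a i)
                                else a l.+1)
        + (-1) ^+ q *: amul (ev G p sg a) (phi (a q0))
      else 0 in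
    if validJ j then ((simp + (-1) ^+ p *: hoch) j.2 : k^o) else 0].

End Filtration.

Definition cohom_dim (k : fieldType) (U V W : vectType k)
  (Cin : {vspace U}) (din : U -> V) (Cmid : {vspace V}) (dout : V -> W) : nat :=
  (\dim (Cmid :&: lker (linfun dout)) - \dim (linfun din @: Cin))%N.

Definition HH_dim (k : fieldType) (N n : nat) (S : nat -> {set {set 'I_N}})
  (f : nat -> 'I_N -> 'I_N) (q : nat) : nat :=
  match q with
  | 0 => cohom_dim (0%VS : {vspace {ffun J N n 0 -> k^o}}) (fun x => x)
                   (Cspace k n S 0) (@Dtot k N n S f 0 : _ -> _)
  | q'.+1 => cohom_dim (Cspace k n S q') (@Dtot k N n S f q')
                       (Cspace k n S q'.+1) (@Dtot k N n S f q'.+1)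
  end.

(* Simplicial cohomology H^q(Sigma; k) via ordered simplicial cochains  *)
(* (vertices ordered by their labels in 'I_N).                          *)
Section SimplicialCohomology.
Variable k : fieldType.
Variable N : nat.
Variable Sg : {set {set 'I_N}}.

Definition simplices (q : nat) : {set {set 'I_N}} :=
  [set s in Sg | #|s| == q.+1].

Definition Sspace (q : nat) : {vspace {ffun {set 'I_N} -> k^o}} :=
  <<[seq [ffun x : {set 'I_N} => ((x == s)%:R : k^o)] | s <- enum (simplices q)]>>%VS.

Definition vsorted (s : {set 'I_N}) : seq 'I_N :=
  sort (fun x y : 'I_N => (x <= y)%N) (enum s).

Definition cobound (q : nat) (phi : {ffun {set 'I_N} -> k^o})
  : {ffun {set 'I_N} -> k^o} :=
  [ffun s : {set 'I_N} =>
     if s \in simplices q.+1 then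
       \sum_(v in s) (-1) ^+ (index v (vsorted s)) * phi (s :\ v)
     else 0].

End SimplicialCohomology.

Definition Hsimp_dim (k : fieldType) (N : nat) (Sg : {set {set 'I_N}}) (q : nat)
  : nat :=
  match q with
  | 0 => cohom_dim (0%VS : {vspace {ffun {set 'I_N} -> k^o}}) (fun x => x)
                   (Sspace k Sg 0) (@cobound k N Sg 0)
  | q'.+1 => cohom_dim (Sspace k Sg q') (@cobound k N Sg q')
                       (Sspace k Sg q'.+1) (@cobound k N Sg q'.+1)
  end.

(* Main.v *)
(** The maps of the filtration are injective, so every complex may be replaced
    by its image in the last one; the Gerstenhaber-Schack complex then has as
    basis the strings c_0 <= ... <= c_p together with a list of gaps between
    consecutive intervals.  Cochains on cells with a non-degenerate gap form a
    contractible summand.  On the remaining cells a list of gaps is a weakly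
    increasing chain of faces, and appending n to the string contracts the
    string direction onto the single string (n).  What is left is the
    unnormalised cochain complex of the nerve of the face poset of the last
    complex, which is compared with ordered simplicial cochains by barycentric
    subdivision and the last vertex map, the homotopy being given by an acyclic
    carrier argument. *)

Require Import Defs.
From HB Require Import structures.
From mathcomp Require Import all_boot all_order all_algebra.
From mathcomp Require Import ring zify.

Set Implicit Arguments.
Unset Strict Implicit.
Unset Printing Implicit Defensive.
Import GRing.Theory.
Local Open Scope ring_scope.

(** The obstacle is that a face of a cell need not be a cell. Dropping the last index of a string
    may leave pairs that do not lie in the smaller complex; dropping an outer gap may leave ends u,
    v with u not contained in v. The corresponding term of the differential is then 0. Cochains are
    therefore functions on all pairs of lists that vanish off the genuine cells, and every
    differential is a signed, weighted deletion of list entries. The homotopy identities become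
    formal statements about lists, and geometry enters through support only. The string direction is
    contractible because a chain of faces whose ends lie in the first complex of the string lies
    there entirely: prolonging the string changes only the last complex and cannot spoil validity.
    All maps are given on cochains, by recursion on lists, as transposes of the usual chain maps.
    Since the claim is one about dimensions, it is enough that simplicial cochains form a strict
    retract of the big complex whose complement is, on cocycles, made of coboundaries. *)

(** * Signed weighted deletion of list entries *)

Section Delta.
Variables (R : comNzRingType) (A : Type).
Implicit Types (w : A -> R) (z : seq A -> R) (s r : seq A).

(** The alternating sum over i of [w] at the i-th entry times [z] without it (see [deltaE]); peeling
    off the head makes its identities plain inductions. Weight 1 gives simplicial differentials,
    while an entry of weight 0 is never deleted. *)
Fixpoint delta w z s : R :=
  if s is x :: s' then w x * z s' - delta w (fun r => z (x :: r)) s' else 0.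

Lemma eq_delta_face w z1 z2 s :
    (forall s1 x s2, s = s1 ++ x :: s2 -> w x != 0 ->
       z1 (s1 ++ s2) = z2 (s1 ++ s2)) ->
  delta w z1 s = delta w z2 s.
Proof.
elim: s z1 z2 => [|x s IHs] z1 z2 eq_z //=.
congr (_ - _); last first.
  by apply: IHs => s1 y s2 Ds; apply: (eq_z (x :: s1) y s2); rewrite Ds.
have [->|wx] := eqVneq (w x) 0; first by rewrite !mul0r.
by congr (_ * _); apply: (eq_z [::] x s).
Qed.

Lemma eq_delta w z1 z2 s : z1 =1 z2 -> delta w z1 s = delta w z2 s.
Proof. by move=> eq_z; apply: eq_delta_face => *; apply: eq_z. Qed.

Lemma eq_delta_wt w1 w2 z s : w1 =1 w2 -> delta w1 z s = delta w2 z s.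
Proof. by move=> eq_w; elim: s z => //= x s IHs z; rewrite eq_w IHs. Qed.

Lemma delta_face0 w z s :
    (forall s1 x s2, s = s1 ++ x :: s2 -> w x != 0 -> z (s1 ++ s2) = 0) ->
  delta w z s = 0.
Proof.
move=> z0; rewrite (@eq_delta_face _ _ (fun=> 0)) //.
by elim: s {z0} => //= x s ->; rewrite mulr0 subr0.
Qed.

Lemma deltaZD w a z1 z2 s :
  delta w (fun r => a * z1 r + z2 r) s = a * delta w z1 s + delta w z2 s.
Proof.
elim: s z1 z2 => [|x s IHs] z1 z2 /=; first by rewrite mulr0 addr0.
by rewrite IHs; ring.
Qed.

Lemma deltaZ w a z s : delta w (fun r => a * z r) s = a * delta w z s.
Proof.
elim: s z => [|x s IHs] z /=; first by rewrite mulr0.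
by rewrite IHs; ring.
Qed.

Lemma deltaD w z1 z2 s :
  delta w (fun r => z1 r + z2 r) s = delta w z1 s + delta w z2 s.
Proof.
by rewrite -[delta w z1 s]mul1r -deltaZD; apply: eq_delta => r; rewrite mul1r.
Qed.

Lemma deltaN w z s : delta w (fun r => - z r) s = - delta w z s.
Proof.
by rewrite -mulN1r -deltaZ; apply: eq_delta => r; rewrite mulN1r.
Qed.

Lemma deltaB w z1 z2 s :
  delta w (fun r => z1 r - z2 r) s = delta w z1 s - delta w z2 s.
Proof. by rewrite deltaD deltaN. Qed.

(** A weight depending only on the deleted entry keeps the usual cancellation: both orders of
    deleting two entries carry the same product of weights and opposite signs. *)
Lemma delta_delta w z s : delta w (delta w z) s = 0.
Proof.
elim: s z => [|x s IHs] z //=.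
by rewrite deltaB deltaZ IHs subr0 subrr.
Qed.

Lemma delta_rcons w z s x :
  delta w z (rcons s x) =
    delta w (fun r => z (rcons r x)) s + (-1) ^+ size s * w x * z s.
Proof.
elim: s z => [|y s IHs] z /=; first by rewrite add0r subr0 mul1r.
by rewrite IHs exprS; ring.
Qed.

(** Deletion lowers the size by one, hence anticommutes with the sign given by the size; the signs
    of the total complex are handled through this. *)
Lemma delta_sign w z s :
  delta w (fun r => (-1) ^+ size r * z r) s = - (-1) ^+ size s * delta w z s.
Proof.
case: s => [|x s]; first by rewrite mulr0.
rewrite -deltaZ; apply: eq_delta_face => s1 y s2 def_s _.
by rewrite def_s !size_cat /= addnS exprS mulN1r opprK.
Qed.

Lemma deltaE w z s x0 :
  delta w z s = \sum_(i < size s)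
     (-1) ^+ i * w (nth x0 s i) * z (take i s ++ drop i.+1 s).
Proof.
elim: s z => [|x s IHs] z /=; first by rewrite big_ord0.
rewrite big_ord_recl /= drop0 mul1r IHs -sumrN; congr (_ + _).
by apply: eq_bigr => i _; rewrite exprS mulN1r !mulNr.
Qed.

End Delta.

Lemma delta_map (R : comNzRingType) (A B : Type) (h : A -> B) (w : B -> R) z s :
  delta w z (map h s) = delta (w \o h) (z \o map h) s.
Proof. by elim: s z => //= x s IHs z; rewrite IHs. Qed.

Lemma delta_swap (R : comNzRingType) (A B : Type) (w : A -> R) (w' : B -> R)
    (z : seq A -> seq B -> R) s t :
  delta w (fun r => delta w' (z r) t) s =
  delta w' (fun r => delta w (z^~ r) s) t.
Proof.
elim: s z => [|x s IHs] z /=; first by rewrite delta_face0.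
by rewrite deltaB deltaZ IHs.
Qed.

(** * The total differential on cells and its homotopies *)

Section CellHomotopy.
Variables (R : comNzRingType) (I : Type) (T : eqType).
Implicit Types (s : seq I) (g : seq (T * T)) (Z : seq I -> seq (T * T) -> R).

Definition diagonal (e : T * T) := e.1 == e.2.
Definition diag_wt (e : T * T) : R := (diagonal e)%:R.

(** A string c_0, ..., c_p has size p+1, so the exponent [(size s).+1] gives the sign (-1)^p of the
    Hochschild differential in the total complex. *)
Definition dcell Z s g : R :=
  delta (fun=> 1) (Z^~ g) s + (-1) ^+ (size s).+1 * delta diag_wt (Z s) g.

Lemma eq_dcell Z1 Z2 s g :
    (forall s1 i s2, s = s1 ++ i :: s2 -> Z1 (s1 ++ s2) g = Z2 (s1 ++ s2) g) ->
    (forall g1 e g2, g = g1 ++ e :: g2 -> diagonal e ->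
       Z1 s (g1 ++ g2) = Z2 s (g1 ++ g2)) ->
  dcell Z1 s g = dcell Z2 s g.
Proof.
move=> eq_s eq_g; rewrite /dcell; congr (_ + _ * _).
  by apply: eq_delta_face => s1 i s2 Ds _; apply: eq_s Ds.
apply: eq_delta_face => g1 e g2 Dg; rewrite /diag_wt.
by case: (boolP (diagonal e)) => [de _|_]; [apply: eq_g Dg de | rewrite eqxx].
Qed.

Lemma dcell_dcell Z s g : dcell (dcell Z) s g = 0.
Proof.
rewrite /dcell deltaD (delta_delta _ (Z^~ g)) deltaD deltaZ delta_delta.
rewrite -delta_swap mulr0 addr0 add0r.
under eq_delta => r do rewrite exprS mulN1r mulNr.
by rewrite deltaN delta_sign exprS; ring.
Qed.

Fixpoint gap_htpy (z : seq (T * T) -> R) g : R :=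
  if g is e :: g' then
    if diagonal e then - gap_htpy (fun r => z (e :: r)) g'
    else z ((e.1, e.1) :: e :: g')
  else 0.

Lemma eq_gap_htpy z1 z2 g : z1 =1 z2 -> gap_htpy z1 g = gap_htpy z2 g.
Proof.
elim: g z1 z2 => //= e g IHg z1 z2 eq_z; case: ifP => // _.
by congr (- _); apply: IHg => r.
Qed.

Lemma gap_htpyZD a z1 z2 g :
  gap_htpy (fun r => a * z1 r + z2 r) g = a * gap_htpy z1 g + gap_htpy z2 g.
Proof.
elim: g z1 z2 => [|e g IHg] z1 z2 /=; first by rewrite mulr0 addr0.
by case: ifP => // _; rewrite IHg; ring.
Qed.

Lemma gap_htpyB z1 z2 g :
  gap_htpy (fun r => z1 r - z2 r) g = gap_htpy z1 g - gap_htpy z2 g.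
Proof.
rewrite addrC -mulN1r -gap_htpyZD.
by apply: eq_gap_htpy => r; rewrite mulN1r addrC.
Qed.

Lemma gap_htpyZ a z g : gap_htpy (fun r => a * z r) g = a * gap_htpy z g.
Proof.
elim: g z => [|e g IHg] z /=; first by rewrite mulr0.
by case: ifP => // _; rewrite IHg mulrN.
Qed.

Lemma gap_htpy_eq0 z g :
    (forall g1 e g2, g = g1 ++ e :: g2 ->
       z (g1 ++ (e.1, e.1) :: e :: g2) = 0) ->
  gap_htpy z g = 0.
Proof.
elim: g z => [|e g IHg] z z0 //=; case: ifP => _; last exact: (z0 [::]).
by rewrite IHg ?oppr0 // => g1 f g2 Dg; apply: (z0 (e :: g1)); rewrite Dg.
Qed.

(** Deleting the inserted gap gives the list back. All other deletions commute with the insertion up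
    to sign, because the first non-diagonal gap has weight 0 and stays first. *)
Lemma gap_htpy_delta z g :
  delta diag_wt (gap_htpy z) g + gap_htpy (delta diag_wt z) g =
    if all diagonal g then 0 else z g.
Proof.
elim: g z => [|e g IHg] z /=; first by rewrite addr0.
have [de|nde] /= := boolP (diagonal e).
  have dw : diag_wt e = 1 by rewrite /diag_wt de.
  rewrite deltaN dw gap_htpyB -(IHg (fun r => z (e :: r))).
  have -> : gap_htpy (fun r => 1 * z r) g = gap_htpy z g.
    by apply: eq_gap_htpy => r; rewrite mul1r.
  ring.
by rewrite /diag_wt /= (negPf nde) /diagonal eqxx mulr0n mulr1n; ring.
Qed.

Lemma delta_gap_htpy (w : I -> R) (Z : seq I -> seq (T * T) -> R) s g :
  delta w (fun r => gap_htpy (Z r) g) s =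
    gap_htpy (fun h => delta w (Z^~ h) s) g.
Proof.
elim: s Z => [|x s IHs] Z /=.
  rewrite -[LHS](mul0r (gap_htpy (fun=> 0) g)) -gap_htpyZ.
  by apply: eq_gap_htpy => h; rewrite mul0r.
by rewrite gap_htpyB gap_htpyZ IHs.
Qed.

Variable top : I.

Definition string_htpy (z : seq I -> R) s : R :=
  if s is [::] then 0 else (-1) ^+ size s * z (rcons s top).

Lemma string_htpyE z s :
  (0 < size s)%N -> string_htpy z s = (-1) ^+ size s * z (rcons s top).
Proof. by case: s. Qed.

(** The cone with apex [top] would contract everything if the empty string counted; cutting it off
    leaves the value at [[:: top]] on strings of length one. *)
Lemma string_htpy_delta z s :
  (0 < size s)%N ->
  delta (fun=> 1) (string_htpy z) s + string_htpy (delta (fun=> 1) z) s =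
    z s - (if size s == 1 then z [:: top] else 0).
Proof.
move=> s_gt0; rewrite [string_htpy _ s]string_htpyE // delta_rcons mulr1 mulrDr.
rewrite mulrA -expr2 sqrr_sign mul1r.
case def_s: s s_gt0 => [|x [|y s']] // _; first by rewrite /=; ring.
rewrite -def_s (@eq_delta_face _ _ _ (string_htpy z)
           (fun r => (-1) ^+ size r * z (rcons r top))).
  have -> : (size s == 1) = false by rewrite def_s.
  by rewrite delta_sign; ring.
by move=> [|x1 s1] y1 s2; rewrite def_s //; case=> _ <-.
Qed.

(* Non-diagonal gaps are never deleted, so cells with such a gap form a
   direct summand, contracted by doubling the left end of the first one; the
   all-diagonal cells are pushed to the string [:: top]. *)
Definition cell_htpy Z s g : R :=
  if all diagonal g then string_htpy (Z^~ g) s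
  else (-1) ^+ (size s).+1 * gap_htpy (Z s) g.

(** The gap homotopy does not touch the string, so on cells with a non-diagonal gap the two string
    differentials cancel by sign; on all-diagonal cells the roles of strings and gaps are
    exchanged. *)
Lemma cell_htpy_dcell Z s g :
  (0 < size s)%N ->
  dcell (cell_htpy Z) s g + cell_htpy (dcell Z) s g =
    Z s g - (if (size s == 1) && all diagonal g then Z [:: top] g else 0).
Proof.
have sgn2 m : (-1) ^+ m * (-1) ^+ m = 1 :> R by rewrite -expr2 sqrr_sign.
move=> s_gt0; have [dg|ndg] /= := boolP (all diagonal g); last first.
  rewrite andbF subr0.
  have D1 : delta (fun=> 1) ((cell_htpy Z)^~ g) s =
      (-1) ^+ size s * gap_htpy (fun h => delta (fun=> 1) (Z^~ h) s) g.
    rewrite (@eq_delta _ _ _ _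
               (fun r => (-1) ^+ size r * - gap_htpy (Z r) g)).
      by rewrite delta_sign deltaN delta_gap_htpy mulrNN.
    by move=> r; rewrite /cell_htpy (negPf ndg) exprS; ring.
  have D2 : delta diag_wt (cell_htpy Z s) g =
      (-1) ^+ (size s).+1 * delta diag_wt (gap_htpy (Z s)) g.
    rewrite -deltaZ; apply: eq_delta_face.
    move=> g1 e g2 def_g; rewrite /diag_wt.
    case: (boolP (diagonal e)) => [de _|]; last by rewrite eqxx.
    rewrite /cell_htpy; suff /negPf-> : ~~ all diagonal (g1 ++ g2) by [].
    by move: ndg; rewrite def_g !all_cat /= de.
  rewrite {1}/dcell D1 D2 /cell_htpy (negPf ndg).
  rewrite (@eq_gap_htpy (dcell Z s) (fun h =>
    (-1) ^+ (size s).+1 * delta diag_wt (Z s) h + delta (fun=> 1) (Z^~ h) s));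
    last by move=> h; rewrite /dcell addrC.
  rewrite gap_htpyZD; have := gap_htpy_delta (Z s) g; rewrite (negPf ndg).
  move=> <-; rewrite exprS mulN1r -[RHS]mul1r -[1 in RHS](sgn2 (size s)); ring.
rewrite andbT /dcell.
have D1 : delta (fun=> 1) ((cell_htpy Z)^~ g) s =
    delta (fun=> 1) (string_htpy (Z^~ g)) s.
  by apply: eq_delta => r; rewrite /cell_htpy dg.
have D2 : delta diag_wt (cell_htpy Z s) g =
    (-1) ^+ size s * delta diag_wt (Z (rcons s top)) g.
  rewrite -deltaZ; apply: eq_delta_face => g1 e g2 def_g _.
  rewrite /cell_htpy -(string_htpyE (Z^~ (g1 ++ g2))) //.
  suff -> : all diagonal (g1 ++ g2) by [].
  by move: dg; rewrite def_g !all_cat /= => /and3P[-> _ ->].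
rewrite -(string_htpy_delta (Z^~ g)) // D1 D2 /cell_htpy dg !string_htpyE //.
rewrite size_rcons !exprS; ring.
Qed.

End CellHomotopy.

(** * The transpose of barycentric subdivision *)

Section Subdivision.
Variables (R : comNzRingType) (A B : Type) (bary : seq A -> B).
Implicit Types (z : seq B -> R) (v : seq A).

(* [sd] is the transpose of barycentric subdivision, which is the cone from
   the barycentre over the subdivided boundary; the fuel [m] is [size v]. *)
Fixpoint sd_rec m z v : R :=
  if m is m'.+1 then
    (-1) ^+ m' * delta (fun=> 1) (sd_rec m' (fun c => z (rcons c (bary v)))) v
  else z [::].

Definition sd z v := sd_rec (size v) z v.

Lemma sdE z v : (0 < size v)%N ->
  sd z v =
  (-1) ^+ (size v).-1 * delta (fun=> 1) (sd (fun c => z (rcons c (bary v)))) v.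
Proof.
rewrite /sd; case def_v: (size v) => [|m] //= _; congr (_ * _).
apply: eq_delta_face => v1 x v2 Dv _; congr (sd_rec _ _ _).
by move: def_v; rewrite Dv !size_cat /= addnS => -[].
Qed.

Lemma eq_sd z1 z2 v : z1 =1 z2 -> sd z1 v = sd z2 v.
Proof.
rewrite /sd; move: (size v) => m; elim: m v z1 z2 => [|m IHm] v z1 z2 eq_z //=.
by congr (_ * _); apply: eq_delta => r; apply: IHm.
Qed.

Lemma sdZD a z1 z2 v : sd (fun c => a * z1 c + z2 c) v = a * sd z1 v + sd z2 v.
Proof.
rewrite /sd; move: (size v) => m; elim: m v z1 z2 => [|m IHm] v z1 z2 //=.
by under eq_delta do rewrite IHm; rewrite deltaZD; ring.
Qed.

Lemma sdZ a z v : sd (fun c => a * z c) v = a * sd z v.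
Proof.
rewrite /sd; move: (size v) => m; elim: m v z => [|m IHm] v z //=.
by under eq_delta do rewrite IHm; rewrite deltaZ; ring.
Qed.

Lemma sd_sign z v :
  sd (fun c => (-1) ^+ size c * z c) v = (-1) ^+ size v * sd z v.
Proof.
move: {2}(size v) (leqnn (size v)) => m.
elim: m v z => [|m IHm] v z; first by case: v => // _; rewrite /sd.
rewrite leq_eqVlt => /predU1P[size_v|]; last exact: IHm.
rewrite !sdE ?size_v //= mulrCA; congr (_ * _); rewrite -deltaZ.
apply: eq_delta_face => v1 x v2 Dv _.
have size_r : size (v1 ++ v2) = m.
  by move: size_v; rewrite Dv !size_cat /= addnS => -[].
rewrite (@eq_sd _ (fun c => (-1) ^+ size c * - z (rcons c (bary v)))).
  rewrite IHm ?size_r // (@eq_sd _ (fun c => -1 * z (rcons c (bary v)))).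
    by rewrite sdZ exprS; ring.
  by move=> c; rewrite mulN1r.
by move=> c; rewrite size_rcons exprS; ring.
Qed.

(** On every facet, the coboundary of [z] coned off at the barycentre is the coboundary of the coned
    cochain plus, up to sign, [z] itself. Summed over the facets, the first part dies by
    [delta_delta] and the second is the claim. *)
Lemma sd_delta z v : sd (delta (fun=> 1) z) v = delta (fun=> 1) (sd z) v.
Proof.
move: {2}(size v) (leqnn (size v)) => m.
elim: m v z => [|m IHm] v z; first by case: v.
rewrite leq_eqVlt => /predU1P[size_v|]; last exact: IHm.
rewrite sdE ?size_v //=.
set zv := fun c => z (rcons c (bary v)).
rewrite (@eq_delta_face _ _ _ _
           (fun r => delta (fun=> 1) (sd zv) r + (-1) ^+ size r * sd z r)).
  rewrite deltaD delta_delta add0r delta_sign size_v exprS; set u := _ ^+ m.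
  by rewrite mulN1r opprK mulrA -expr2 sqrr_sign mul1r.
move=> v1 x v2 Dv _.
have size_r : (size (v1 ++ v2) <= m)%N.
  by move: size_v; rewrite Dv !size_cat /= addnS => -[<-].
rewrite (@eq_sd _ (fun c => 1 * delta (fun=> 1) zv c + (-1) ^+ size c * z c)).
  by rewrite sdZD mul1r IHm // sd_sign.
by move=> c; rewrite delta_rcons mul1r mulr1.
Qed.

End Subdivision.

(** * Homotopy from an operator to the identity by acyclic carriers *)

Section AcyclicHomotopy.
Variables (R : comNzRingType) (B : Type) (b0 : B).
Variable e : (seq B -> R) -> seq B -> R.
Implicit Types (z : seq B -> R) (c : seq B).

Hypothesis eZD : forall a z1 z2 c,
  e (fun d => a * z1 d + z2 d) c = a * e z1 c + e z2 c.
Hypothesis eq_e : forall z1 z2 c, z1 =1 z2 -> e z1 c = e z2 c.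
Hypothesis e_sign : forall z c,
  e (fun d => (-1) ^+ size d * z d) c = (-1) ^+ size c * e z c.
Hypothesis e_nil : forall z, e z [::] = z [::].

Let e0 c : e (fun=> 0) c = 0.
Proof.
rewrite -[RHS](subrr (e (fun=> 0) c)) addrC -mulN1r -eZD.
by apply: eq_e => d; rewrite mulr0 addr0.
Qed.

Let eZ a z c : e (fun d => a * z d) c = a * e z c.
Proof.
rewrite -[RHS]addr0 -(e0 c) -eZD.
by apply: eq_e => d; rewrite addr0.
Qed.

(* The usual acyclic-carrier recursion: every chain [c] lies in the cone with
   apex [last c], where z - e z - delta (htpy z) can be coned off. *)
Fixpoint cone_htpy_rec m z c : R :=
  if m is m'.+1 then
    let z' d := z (rcons d (last b0 c)) in
    (-1) ^+ m * (z' c - e z' c - delta (fun=> 1) (cone_htpy_rec m' z') c)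
  else 0.

Definition cone_htpy z c := cone_htpy_rec (size c) z c.

Lemma cone_htpyE z c : (0 < size c)%N ->
  let z' d := z (rcons d (last b0 c)) in
  cone_htpy z c =
  (-1) ^+ size c * (z' c - e z' c - delta (fun=> 1) (cone_htpy z') c).
Proof.
rewrite /cone_htpy; case def_c: (size c) => [|m] //= _.
congr (_ * (_ - _)); apply: eq_delta_face => v1 x v2 Dc _.
congr (cone_htpy_rec _ _ _).
by move: def_c; rewrite Dc !size_cat /= addnS => -[].
Qed.

Lemma eq_cone_htpy z1 z2 c : z1 =1 z2 -> cone_htpy z1 c = cone_htpy z2 c.
Proof.
rewrite /cone_htpy; move: (size c) => m;
  elim: m c z1 z2 => [|m IHm] c z1 z2 eq_z //=.
congr (_ * (_ - _ - _)); first by rewrite eq_z.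
  by apply: eq_e => d; rewrite eq_z.
by apply: eq_delta => r; apply: IHm => d; rewrite eq_z.
Qed.

Lemma cone_htpyZD a z1 z2 c :
  cone_htpy (fun d => a * z1 d + z2 d) c = a * cone_htpy z1 c + cone_htpy z2 c.
Proof.
rewrite /cone_htpy; move: (size c) => m; elim: m c z1 z2 => [|m IHm] c z1 z2 /=.
  by rewrite mulr0 addr0.
by rewrite eZD; under eq_delta do rewrite IHm; rewrite deltaZD; ring.
Qed.

Lemma cone_htpy0 c : cone_htpy (fun=> 0) c = 0.
Proof.
rewrite -[RHS](subrr (cone_htpy (fun=> 0) c)) addrC -mulN1r -cone_htpyZD.
by apply: eq_cone_htpy => d; rewrite mulr0 addr0.
Qed.

Lemma cone_htpyZ a z c : cone_htpy (fun d => a * z d) c = a * cone_htpy z c.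
Proof.
rewrite -[RHS]addr0 -(cone_htpy0 c) -cone_htpyZD.
by apply: eq_cone_htpy => d; rewrite addr0.
Qed.

Lemma cone_htpy_sign z c :
  cone_htpy (fun d => (-1) ^+ size d * z d) c =
    - (-1) ^+ size c * cone_htpy z c.
Proof.
move: {2}(size c) (leqnn (size c)) => m.
elim: m c z => [|m IHm] c z; first by case: c => // _; rewrite mulr0.
rewrite leq_eqVlt => /predU1P[size_c|]; last exact: IHm.
rewrite !cone_htpyE ?size_c //= mulrCA; congr (_ * _).
set x := last b0 c; set z' := fun d => z (rcons d x).
have eq_z d : (-1) ^+ size (rcons d x) * z (rcons d x) =
              -1 * ((-1) ^+ size d * z' d).
  by rewrite size_rcons exprS mulrA.
rewrite eq_z (eq_e _ eq_z) eZ e_sign size_c.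
rewrite (@eq_delta_face _ _ _ _ (fun r => (-1) ^+ size r * cone_htpy z' r)).
  by rewrite delta_sign size_c -[z (rcons c x)]/(z' c); ring.
move=> c1 x1 c2 Dc _; rewrite (eq_cone_htpy _ eq_z) cone_htpyZ IHm; first ring.
by move: size_c; rewrite Dc !size_cat /= addnS => -[<-].
Qed.

(** Commutation of [e] with the differential is asked on [good] lists only, a class closed under
    deletion: the last vertex map respects coboundaries on chains of faces, not on arbitrary
    lists. *)
Lemma cone_htpy_delta (good : seq B -> Prop) z c :
    (forall c1 x c2, good (c1 ++ x :: c2) -> good (c1 ++ c2)) ->
    (forall z c, good c ->
       e (delta (fun=> 1) z) c = delta (fun=> 1) (e z) c) ->
  good c ->
  cone_htpy (delta (fun=> 1) z) c + delta (fun=> 1) (cone_htpy z) c =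
    z c - e z c.
Proof.
move=> good_face e_delta; move: {2}(size c) (leqnn (size c)) => m.
elim: m c z => [|m IHm] c z; first by case: c => // *;
  rewrite e_nil addr0 subrr.
rewrite leq_eqVlt => /predU1P[size_c good_c|]; last exact: IHm.
rewrite cone_htpyE ?size_c //=.
set x := last b0 c; set z' := fun d => z (rcons d x).
have eq_z d : delta (fun=> 1) z (rcons d x) =
              1 * delta (fun=> 1) z' d + (-1) ^+ size d * z d.
  by rewrite delta_rcons mul1r mulr1.
rewrite eq_z (eq_e _ eq_z) eZD e_sign e_delta //.
(* The induction hypothesis is used on each face of [c], but with the apex [x] of [c] itself, even
   on the face that drops the last entry. *)
have -> : delta (fun=> 1)
     (cone_htpy (fun d => delta (fun=> 1) z (rcons d x))) c =
   delta (fun=> 1) z' c - delta (fun=> 1) (e z') c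
   + (-1) ^+ size c * delta (fun=> 1) (cone_htpy z) c.
  rewrite (@eq_delta_face _ _ _ _
     (fun r => (z' r - e z' r - delta (fun=> 1) (cone_htpy z') r)
               - (-1) ^+ size r * cone_htpy z r)).
    rewrite !deltaB delta_delta delta_sign; ring.
  move=> c1 x1 c2 Dc _; rewrite (eq_cone_htpy _ eq_z) cone_htpyZD.
  rewrite cone_htpy_sign -IHm; first ring.
    by move: size_c; rewrite Dc !size_cat /= addnS => -[<-].
  by apply: (good_face _ x1); rewrite -Dc.
rewrite size_c; set u := _ ^+ _.
have uu : u * u = 1 by rewrite -expr2 sqrr_sign.
set a := delta _ z' c; set b := delta _ (e z') c;
  set d := delta _ (cone_htpy z) c.
transitivity ((u * u) * (z c - e z c) + (1 - u * u) * d); first ring.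
by rewrite uu; ring.
Qed.

End AcyclicHomotopy.

(** * The last vertex map and the nerve of the face poset *)

(** Deleting either copy of the repeated entry gives the same list with opposite signs; every other
    deletion keeps the repetition. *)
Lemma delta_repeat (R : comNzRingType) (A : Type) (z : seq A -> R) s1 x s2 :
    (forall r1 r2, z (r1 ++ x :: x :: r2) = 0) ->
  delta (fun=> 1) z (s1 ++ x :: x :: s2) = 0.
Proof.
elim: s1 z => [|y s1 IHs] z z0 /=.
  by rewrite opprB addrC subrK delta_face0 // => *; apply: (z0 [::]).
by rewrite z0 mulr0 IHs ?subr0 // => r1 r2; apply: (z0 (y :: r1)).
Qed.

Lemma sorted_leq_repeat s :
  sorted leq s -> ~~ sorted ltn s -> exists s1 x s2, s = s1 ++ x :: x :: s2.
Proof.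
elim: s => [|x [|y s] IHs] //= /andP[le_xy le_s].
rewrite negb_and -leqNgt orbC; case: (boolP (path ltn y s)) =>
  [_ /= le_yx|nlt _].
  exists [::], x, s; suff -> : y = x by [].
  by apply/eqP; rewrite eqn_leq le_yx le_xy.
by have [s1 [u [s2 ->]]] := IHs le_s nlt; exists (x :: s1), u, s2.
Qed.

Section LastVertex.
Variables (R : comNzRingType) (N : nat).
Local Notation face := {set 'I_N}.
Implicit Types (x y X : face) (S : {set face}) (c d : seq face) (v r : seq nat).
Implicit Types (g : seq nat -> R) (z : seq face -> R).

Definition vset v : face := [set i | val i \in v].
Definition maxv x := \max_(i in x) val i.

(** Repetitions are allowed: these are the simplices of the unnormalised nerve. [X] is the carrier,
    which shrinks to the apex whenever a cone is taken. *)
Definition chain S X c :=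
  sorted (fun x y : face => x \subset y) c
  && all (fun x => (x \in S) && (x \subset X)) c.

(** Maxima increase weakly along a chain; when two of them agree, the image simplex is degenerate
    and gets the value 0. *)
Definition last_vertex g c : R :=
  if sorted ltn (map maxv c) then g (map maxv c) else 0.

Lemma vsetS r v : {subset r <= v} -> vset r \subset vset v.
Proof. by move=> sub_rv; apply/subsetP => i; rewrite !inE => /sub_rv. Qed.

Lemma maxvS x y : x \subset y -> (maxv x <= maxv y)%N.
Proof.
by move=> /subsetP sub_xy; apply/bigmax_leqP => i /sub_xy;
  apply: leq_bigmax_cond.
Qed.

Lemma maxv_mem x : x != set0 -> exists2 i, i \in x & maxv x = val i.
Proof.
rewrite -card_gt0 => /(eq_bigmax_cond (val : 'I_N -> nat))[i xi Dm].
by exists i.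
Qed.

Lemma maxv_vset_rcons r m :
  (m < N)%N -> all (leq^~ m) r -> maxv (vset (rcons r m)) = m.
Proof.
move=> lt_mN /allP le_rm; apply/eqP; rewrite eqn_leq; apply/andP; split.
  apply/bigmax_leqP => i; rewrite inE mem_rcons inE => /predU1P[-> //|].
  exact: le_rm.
rewrite -[leqLHS]/(val (Ordinal lt_mN)); apply: leq_bigmax_cond.
by rewrite inE mem_rcons mem_head.
Qed.

Lemma chain_face S X c d : subseq d c -> chain S X c -> chain S X d.
Proof.
move=> sub_dc /andP[sc ac]; apply/andP; split.
  by apply: subseq_sorted sub_dc sc => y x w; apply: subset_trans.
by apply/allP => x /(mem_subseq sub_dc)/(allP ac).
Qed.

Lemma chain_cone S X c x :
  x \in S -> x \subset X -> chain S x c -> chain S X (rcons c x).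
Proof.
move=> xS sxX /andP[sc ac]; apply/andP; split; last first.
  rewrite all_rcons xS sxX; apply/allP => y /(allP ac)/andP[-> yx].
  exact: subset_trans sxX.
move: sc ac; case: c => //= y c; rewrite rcons_path => -> /andP[/andP[_ yx] ac].
have := mem_last y c; rewrite inE => /predU1P[-> //|].
by move=> /(allP ac)/andP[].
Qed.

Lemma chain_last S X c : chain S X c -> chain S (last set0 c) c.
Proof.
move=> /andP[sc ac]; rewrite /chain sc; apply/allP => x cx.
have /andP[-> _] := allP ac _ cx; move: cx.
elim/last_ind: c sc {ac} => // c y _; rewrite last_rcons => sc.
have tr : transitive (fun x y : face => x \subset y).
  by move=> w u t; apply: subset_trans.
move: sc; rewrite sorted_pairwise // pairwise_rcons => /andP[/allP ay _].
by rewrite mem_rcons inE /= => /predU1P[->|/ay].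
Qed.

Lemma chain_last_mem S X c : (0 < size c)%N -> chain S X c ->
  (last set0 c \in S) && (last set0 c \subset X).
Proof.
case: c => // x c _ /andP[_ /allP ac]; apply: ac.
by rewrite /= mem_last.
Qed.

Lemma sorted_maxv S X c : chain S X c -> sorted leq (map maxv c).
Proof.
move=> /andP[sc _]; rewrite sorted_map; apply: sub_sorted sc => x y.
exact: maxvS.
Qed.

Lemma last_vertex_delta g c : sorted leq (map maxv c) ->
  last_vertex (delta (fun=> 1) g) c = delta (fun=> 1) (last_vertex g) c.
Proof.
move=> le_c; rewrite /last_vertex.
rewrite -(delta_map maxv (fun=> 1) (fun r => if sorted ltn r then g r else 0)).
case: ifPn => [lt_c | nlt_c].
  apply: eq_delta_face => s1 y s2 Ds _; suff -> : sorted ltn (s1 ++ s2) by [].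
  apply: subseq_sorted lt_c; first exact: ltn_trans.
  by rewrite Ds cat_subseq // subseq_cons.
have [s1 [y [s2 ->]]] := sorted_leq_repeat le_c nlt_c.
rewrite delta_repeat // => r1 r2; rewrite ifF //; apply/negP.
by rewrite sorted_pairwise; [rewrite pairwise_cat /= ltnn !andbF | apply:
  ltn_trans].
Qed.

(** Subdividing [v] meets only flags of nonempty subsets of [v]; at each cone the carrier shrinks
    from [X] to [vset v]. *)
Lemma eq_sd_chain S X z1 z2 v :
    (forall r, subseq r v -> r != [::] -> vset r \in S) ->
    vset v \subset X ->
    (forall c, chain S X c -> size c = size v -> z1 c = z2 c) ->
  sd vset z1 v = sd vset z2 v.
Proof.
move: {2}(size v) (leqnn (size v)) => m.
elim: m v X z1 z2 => [|m IHm] v X z1 z2.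
  by case: v => // _ _ _ eq_z; apply: eq_z.
rewrite leq_eqVlt => /predU1P[size_v vS sub_vX eq_z|]; last exact: IHm.
rewrite !sdE ?size_v //; congr (_ * _); apply: eq_delta_face => r1 y r2 Dv _.
have sub_r : subseq (r1 ++ r2) v by rewrite Dv cat_subseq // subseq_cons.
have size_r : size (r1 ++ r2) = m.
  by move: size_v; rewrite Dv !size_cat /= addnS => -[].
apply: (IHm _ (vset v)); first by rewrite size_r.
- by move=> r sub_rr; apply: vS; apply: subseq_trans sub_r.
- exact/vsetS/mem_subseq.
move=> c cc size_c; apply: eq_z; last by rewrite size_rcons size_c size_r.
by apply: chain_cone => //; apply: vS => //; rewrite -size_eq0 size_v.
Qed.

(** Of all flags of [v], only the one dropping the largest vertex at each step has strictly
    increasing maxima: a facet that keeps it repeats the maximum. The sign of this flag is that of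
    the last deletion times that of the cone, hence +1. *)
Lemma sd_last_vertex g v :
  sorted ltn v -> all (ltn^~ N) v -> sd vset (last_vertex g) v = g v.
Proof.
elim/last_ind: v g => [|v x IHv] g //.
rewrite (sorted_pairwise ltn_trans) pairwise_rcons => /andP[lt_vx lt_v].
rewrite all_rcons => /andP[ltxN ltvN].
have max_x r : subseq r v -> maxv (vset (rcons r x)) = x.
  move=> /mem_subseq sub_rv; apply: maxv_vset_rcons => //.
  by apply/allP => y /sub_rv/(allP lt_vx)/ltnW.
rewrite sdE size_rcons //= delta_rcons delta_face0 => [|r1 y r2 Dv _];
  last first.
  have sub_r : subseq (r1 ++ r2) v by rewrite Dv cat_subseq // subseq_cons.
  rewrite sdE ?size_rcons //= delta_face0 ?mulr0 // => s1 u s2 _ _.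
  rewrite (@eq_sd _ _ _ _ _ (fun c => 0 * last_vertex g c)) ?sdZ ?mul0r // => c.
  rewrite mul0r /last_vertex ifF // (sorted_pairwise ltn_trans) !map_rcons.
  by rewrite !pairwise_rcons all_rcons !max_x // ltnn.
rewrite add0r mulr1 mulrA -expr2 sqrr_sign mul1r -(IHv (fun r =>
  g (rcons r x))) //; last first.
  by rewrite (sorted_pairwise ltn_trans).
(* No complex is given here, so all nonempty vertex sets are taken; nonemptiness makes the maxima
   attained. *)
apply: (@eq_sd_chain [set~ set0] (vset v)) => // [r sub_r r_n0|c].
  have /hasP[y ry _] : has predT r by rewrite has_predT lt0n size_eq0.
  have ltyN : (y < N)%N by apply: (allP ltvN); apply: mem_subseq ry.
  by rewrite !inE; apply/set0Pn; exists (Ordinal ltyN); rewrite inE.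
move=> /andP[_ ac] _; rewrite /last_vertex map_rcons max_x //.
rewrite !(sorted_pairwise ltn_trans) pairwise_rcons.
suff -> : all (ltn^~ x) (map maxv c) by [].
apply/allP => _ /mapP[y cy ->]; have /andP[] := allP ac _ cy.
rewrite !inE => y_n0 /subsetP sub_yv; have [i yi ->] := maxv_mem y_n0.
by move: (sub_yv _ yi); rewrite inE => /(allP lt_vx).
Qed.

Lemma chain_maxv_lt S X c :
  is_simpcomp S -> chain S X c -> all (ltn^~ N) (map maxv c).
Proof.
move=> [S0 _] /andP[_ /allP ac]; apply/allP => _ /mapP[x cx ->].
have /andP[xS _] := ac _ cx.
have [|i _ ->] := @maxv_mem x; first by apply: contraNneq S0 => <-.
exact: ltn_ord.
Qed.

Lemma vset_maxv_sub S X c r : is_simpcomp S -> chain S X c ->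
  {subset r <= map maxv c} -> vset r \subset X.
Proof.
move=> [S0 _] /andP[_ /allP ac] sub_r.
apply/subsetP => i; rewrite inE => /sub_r/mapP[x cx Dx].
have /andP[xS /subsetP sub_xX] := ac _ cx.
have [|j xj Dj] := @maxv_mem x; first by apply: contraNneq S0 => <-.
by apply: sub_xX; suff -> : i = j by []; apply: val_inj; rewrite Dx.
Qed.

(** The maxima of the members of a chain are vertices of its last member, hence span a face of
    it. *)
Lemma vset_maxv_mem S X c r : is_simpcomp S -> chain S X c ->
  {subset r <= map maxv c} -> r != [::] -> vset r \in S.
Proof.
move=> hS cc sub_r r_n0; have [S0 Sdown] := hS.
have /hasP[y ry _] : has predT r by rewrite has_predT lt0n size_eq0.
have c_gt0 : (0 < size c)%N.
  by have /mapP[x] := sub_r _ ry; case: (c).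
have /andP[xS _] := chain_last_mem c_gt0 cc.
apply: Sdown xS _ _; first exact: vset_maxv_sub hS (chain_last cc) sub_r.
have /(allP (chain_maxv_lt hS cc)) ltyN := sub_r _ ry.
by apply/set0Pn; exists (Ordinal ltyN); rewrite inE.
Qed.

(** Nerve cochains are evaluated on subdivided simplices, then pulled back along the last vertex
    map; this is the operator [e] of the carrier argument. *)
Definition simp_retract z := last_vertex (sd vset z).

Let eq_retract z1 z2 c : z1 =1 z2 -> simp_retract z1 c = simp_retract z2 c.
Proof.
by move=> eq_z; rewrite /simp_retract /last_vertex; case: ifP => // _;
  apply: eq_sd.
Qed.

Let retractZD a z1 z2 c : simp_retract (fun d => a * z1 d + z2 d) c =
  a * simp_retract z1 c + simp_retract z2 c.
Proof.
rewrite /simp_retract /last_vertex; case: ifP => _; first exact: sdZD.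
by rewrite mulr0 addr0.
Qed.

Let retract_sign z c : simp_retract (fun d => (-1) ^+ size d * z d) c =
  (-1) ^+ size c * simp_retract z c.
Proof.
rewrite /simp_retract /last_vertex; case: ifP => _; last by rewrite mulr0.
by rewrite sd_sign size_map.
Qed.

Definition nerve_htpy := cone_htpy set0 simp_retract.

Lemma nerve_htpy0 c : nerve_htpy (fun=> 0) c = 0.
Proof. exact: (cone_htpy0 _ retractZD eq_retract). Qed.

Lemma nerve_htpy_delta S X z c : chain S X c ->
  nerve_htpy (delta (fun=> 1) z) c + delta (fun=> 1) (nerve_htpy z) c =
    z c - simp_retract z c.
Proof.
move=> chain_c.
apply: (@cone_htpy_delta _ _ _ _ retractZD eq_retract
  retract_sign (fun=> erefl) (fun d => chain S X d)) => //.
  by move=> c1 x c2; apply: chain_face; rewrite cat_subseq // subseq_cons.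
move=> {}z {chain_c}c chain_c; rewrite /simp_retract.
rewrite -last_vertex_delta; last exact: sorted_maxv chain_c.
by rewrite /last_vertex; case: ifP => // _; apply: sd_delta.
Qed.

(** The carrier condition: apex, faces and subdivided simplices all stay within chains of [S]. It is
    what allows the homotopy to be applied to a coboundary known to vanish on chains only. *)
Lemma eq_nerve_htpy S X z1 z2 c :
    is_simpcomp S ->
    (forall d, chain S X d -> size d = (size c).+1 -> z1 d = z2 d) ->
    chain S X c ->
  nerve_htpy z1 c = nerve_htpy z2 c.
Proof.
move=> hS; move: {2}(size c) (leqnn (size c)) => m.
elim: m c X z1 z2 => [|m IHm] c X z1 z2; first by case: c.
rewrite leq_eqVlt => /predU1P[size_c eq_z chain_c|]; last exact: IHm.
rewrite /nerve_htpy !cone_htpyE ?size_c //; set x := last set0 c.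
have [xS sub_xX] : x \in S /\ x \subset X.
  by apply/andP; apply: chain_last_mem chain_c; rewrite size_c.
have chain_cx : chain S x c by apply: chain_last chain_c.
have eq_z' d : chain S x d -> size d = size c -> z1 (rcons d x) =
  z2 (rcons d x).
  move=> chain_d size_d; apply: eq_z; last by rewrite size_rcons size_d.
  exact: chain_cone.
congr (_ * (_ - _ - _)); first exact: eq_z'.
  rewrite /simp_retract /last_vertex; case: ifP => // _.
  apply: (@eq_sd_chain S x) => [r sub_r||d chain_d].
  - exact/(vset_maxv_mem hS chain_cx)/mem_subseq.
  - exact: vset_maxv_sub hS chain_cx _.
  - by rewrite size_map; apply: eq_z'.
apply: eq_delta_face => c1 y c2 Dc _.
have size_f : size (c1 ++ c2) = m.
  by move: size_c; rewrite Dc !size_cat /= addnS => -[].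
apply: (IHm _ x); rewrite ?size_f //.
  by move=> d chain_d size_d; apply: eq_z'; rewrite // size_d size_c.
by apply: chain_face chain_cx; rewrite Dc cat_subseq // subseq_cons.
Qed.

End LastVertex.

(** * Valid cells over a nested family of complexes *)

Section NestedCells.
Variables (R : comNzRingType) (N n : nat).
Local Notation face := {set 'I_N}.
Variable L : nat -> {set face}.
Hypothesis L_simpcomp : forall i, (i <= n)%N -> is_simpcomp (L i).
Hypothesis L_mono : forall i j, (i <= j <= n)%N -> L i \subset L j.
Implicit Types (x y : face) (s : seq nat) (g : seq (face * face)) (c :
  seq face).
Implicit Types (Z : seq nat -> seq (face * face) -> R) (z : seq face -> R).

Local Notation e0 := (set0 : face, set0 : face).

Definition face_pair (S : {set face}) x y :=
  [&& x \in S, y \in S & x \subset y].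

Definition link S (d e : face * face) := face_pair S d.2 e.1.

(* A basis cochain of the Gerstenhaber-Schack complex is a string s, a tuple
   (x_1 <= y_1), ..., (x_q <= y_q) in the last complex of s and a pair u <= v in
   the first one.  It is encoded by s and the list of gaps
   (u, x_1), (y_1, x_2), ..., (y_q, v): the Hochschild faces delete a gap whose
   two ends agree. *)
Definition vcell s g : bool :=
  [&& s != [::], g != [::], sorted leq s, all (leq^~ n) s,
      sorted (link (L (last 0%N s))) g
    & face_pair (L (head 0%N s)) (head e0 g).1 (last e0 g).2].

Lemma L_sub i x y : (i <= n)%N -> x \in L i -> y \subset x -> y != set0 ->
  y \in L i.
Proof. by move=> /L_simpcomp[_]; apply. Qed.

Lemma L_n0 i x : (i <= n)%N -> x \in L i -> x != set0.
Proof. by move=> /L_simpcomp[L0 _]; apply: contraTneq => ->. Qed.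

Lemma head_le_last s : sorted leq s -> (head 0 s <= last 0 s)%N.
Proof.
case: s => //= i s /(order_path_min leq_trans)/allP le_s.
by have := mem_last i s; rewrite inE => /predU1P[->|/le_s].
Qed.

Lemma last_le_n s : all (leq^~ n) s -> (last 0 s <= n)%N.
Proof.
by case: s => // i s /allP; apply; rewrite /= mem_last.
Qed.

Lemma L_head_last s : sorted leq s -> all (leq^~ n) s ->
  L (head 0%N s) \subset L (last 0%N s).
Proof. by move=> ss sn; rewrite L_mono // head_le_last // last_le_n. Qed.

Lemma sorted_sub_last c x :
  sorted (fun x y => x \subset y) c -> x \in c -> x \subset last set0 c.
Proof.
move=> sc cx; have: chain setT setT c.
  by rewrite /chain sc; apply/allP => y _; rewrite inE subsetT.
by move=> /chain_last/andP[_ /allP/(_ x cx)/andP[]].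
Qed.

Lemma sorted_sub_head c x :
  sorted (fun x y => x \subset y) c -> x \in c -> head set0 c \subset x.
Proof.
have tr : transitive (fun x y : face => x \subset y).
  by move=> w u t; apply: subset_trans.
case: c => //= y c /(order_path_min tr)/allP sub_y.
by rewrite inE => /predU1P[->|/sub_y].
Qed.

Definition diag c := [seq (x, x) | x <- c].

Lemma diagonalE g : all (@diagonal _) g -> g = diag (map fst g).
Proof.
elim: g => //= -[x y] g IHg /andP[/eqP/= -> dg].
by rewrite /diag /= -/(diag _) -IHg.
Qed.

Lemma all_diag c : all (@diagonal _) (diag c).
Proof. by rewrite all_map; apply/allP => x _; apply: eqxx. Qed.

(** Links are tested in the last complex of the string, yet each member of the chain lies between
    the two ends, which belong to the first complex; as a nonempty subset of the upper end it
    belongs to the first complex too. *)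
Lemma vcell_diag s c :
  vcell s (diag c) =
  [&& s != [::], c != [::], sorted leq s, all (leq^~ n) s
    & chain (L (head 0%N s)) setT c].
Proof.
rewrite /vcell -!size_eq0 size_map; case: s => [|i s] //.
case def_c: c => [|x c'] //; rewrite -def_c.
have -> : (head e0 (diag c)).1 = head set0 c by rewrite def_c.
have -> : (last e0 (diag c)).2 = last set0 c by rewrite /diag last_map.
have cx : head set0 c \in c by rewrite def_c mem_head.
have cy : last set0 c \in c by rewrite def_c /= mem_last.
have -> : size c != 0%N by rewrite def_c.
case sis: (sorted leq (i :: s)); case: (boolP (all _ (i :: s))) => //= sn.
have lein : (i <= n)%N by case/andP: sn.
apply/andP/andP => -[].
  move=> sc /and3P[hc lc _].
  have sc' : sorted (fun x y => x \subset y) c.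
    by move: sc; rewrite /diag sorted_map; apply: sub_sorted => u v /and3P[].
  split=> //; apply/allP => u cu; rewrite subsetT andbT.
  apply: (L_sub lein lc (sorted_sub_last sc' cu)).
  rewrite -subset0; apply: contra (L_n0 lein hc); rewrite -subset0.
  exact/subset_trans/sorted_sub_head.
move=> sc /allP ac.
have inL u : u \in c -> u \in L i by move=> /ac/andP[].
split; last by rewrite /face_pair !inL ?(sorted_sub_last sc).
have /subsetP sub_L := L_head_last sis sn.
rewrite /diag sorted_map; apply: (sub_in_sorted (P := mem c)) sc;
  last exact/allP.
by move=> u v /= /inL/sub_L uL /inL/sub_L vL sub_uv; apply/and3P.
Qed.

Lemma face_pairS (S S' : {set face}) x y :
  S \subset S' -> face_pair S x y -> face_pair S' x y.
Proof. by move=> /subsetP sub_S /and3P[/sub_S xS /sub_S yS xy];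
  apply/and3P. Qed.

Lemma sorted_linkS (S S' : {set face}) g :
  S \subset S' -> sorted (link S) g -> sorted (link S') g.
Proof. by move=> sub_S; apply: sub_sorted => d e; apply: face_pairS. Qed.

Lemma head_rcons_cat (T : Type) (u d : T) (h h' : seq T) :
  head u (rcons h d ++ h') = head u (rcons h d).
Proof. by case: h. Qed.

(** An inner deletion composes the links on both sides; an outer one replaces the lower end by a
    larger face or the upper end by a smaller one. *)
Lemma sorted_link_face S g1 e g2 : diagonal e ->
  sorted (link S) (g1 ++ e :: g2) ->
  [/\ sorted (link S) (g1 ++ g2),
      g1 ++ g2 != [::] ->
        (head e0 (g1 ++ e :: g2)).1 \subset (head e0 (g1 ++ g2)).1
    & g1 ++ g2 != [::] ->
        (last e0 (g1 ++ g2)).2 \subset (last e0 (g1 ++ e :: g2)).2].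
Proof.
move=> /eqP De; case/lastP: g1 => [|h d].
  case: g2 => [|f h2] //= /andP[/and3P[_ _ ef] sf]; split=> //.
  by rewrite De.
rewrite !head_rcons_cat !last_cat sorted_cat_cons last_rcons.
rewrite -[rcons (rcons h d) e]cats1 !cat_rcons sorted_cat_cons /= andbT.
move=> /andP[/andP[sd /and3P[dL eL de]]]; case: g2 => [|f h2] /=.
  by rewrite cats1 -De.
move=> /andP[/and3P[e2L fL ef] sf]; split=> //.
rewrite sorted_cat_cons sd /= sf andbT /link /face_pair dL fL.
by rewrite (subset_trans de) // De.
Qed.

Lemma last_face_le s1 i s2 : sorted leq (s1 ++ i :: s2) ->
  s1 ++ s2 != [::] -> (last 0 (s1 ++ s2) <= last 0 (s1 ++ i :: s2))%N.
Proof.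
case/lastP: s2 => [|s2 j]; last by rewrite -rcons_cons !last_cat !last_rcons.
case/lastP: s1 => [|s1 j] //; rewrite cats0 last_cat last_rcons /=.
by rewrite cat_rcons sorted_cat_cons /= => /and3P[].
Qed.

Lemma head_face_ge s1 i s2 : sorted leq (s1 ++ i :: s2) ->
  s1 ++ s2 != [::] -> (head 0 (s1 ++ i :: s2) <= head 0 (s1 ++ s2))%N.
Proof. by case: s1 => //=; case: s2 => //= j s2 /andP[]. Qed.

(** Only the links can fail, as the last complex may shrink; the first one can only grow. *)
Lemma vcell_sface s1 i s2 g : vcell (s1 ++ i :: s2) g -> s1 ++ s2 != [::] ->
  vcell (s1 ++ s2) g = sorted (link (L (last 0%N (s1 ++ s2)))) g.
Proof.
move=> /and5P[_ g_n0 ss sn /andP[sg bg]] s_n0; rewrite /vcell s_n0 g_n0 /=.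
have sub_s : subseq (s1 ++ s2) (s1 ++ i :: s2).
  by rewrite cat_subseq // subseq_cons.
have sn' : all (leq^~ n) (s1 ++ s2).
  by apply/allP => j /(mem_subseq sub_s)/(allP sn).
rewrite (subseq_sorted leq_trans sub_s ss) sn' /=.
rewrite (face_pairS _ bg) ?andbT // L_mono // head_face_ge //=.
exact: leq_trans (head_le_last (subseq_sorted leq_trans sub_s ss))
  (last_le_n sn').
Qed.

(** Only the order of the new ends can fail. Once it holds, both are trapped between the old ends,
    so they are nonempty faces of the first complex. *)
Lemma vcell_gface s g1 e g2 :
    vcell s (g1 ++ e :: g2) -> diagonal e -> g1 ++ g2 != [::] ->
  vcell s (g1 ++ g2) =
  ((head e0 (g1 ++ g2)).1 \subset (last e0 (g1 ++ g2)).2).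
Proof.
move=> /and5P[s_n0 _ ss sn /andP[sg /and3P[uL vL uv]]] de g_n0.
have [sg' sub_head sub_last] := sorted_link_face de sg.
rewrite /vcell s_n0 g_n0 ss sn sg' /=.
have lehn : (head 0 s <= n)%N := leq_trans (head_le_last ss) (last_le_n sn).
have [{}sub_head {}sub_last] := (sub_head g_n0, sub_last g_n0).
have u'n0 : (head e0 (g1 ++ g2)).1 != set0.
  rewrite -subset0; apply: contra (L_n0 lehn uL); rewrite -subset0.
  exact: subset_trans.
apply/and3P/idP => [[]//|u'v'].
have v'n0 : (last e0 (g1 ++ g2)).2 != set0.
  rewrite -subset0; apply: contra u'n0; rewrite -subset0.
  exact: subset_trans.
have v'L := L_sub lehn vL sub_last v'n0.
by split=> //; apply: L_sub lehn v'L u'v' u'n0.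
Qed.

Definition supported Z := forall s g, ~~ vcell s g -> Z s g = 0.
(** Needed because [dcell] of a supported cochain may be nonzero at an invalid cell, for instance at
    a decreasing string. *)
Definition cut Z s g := if vcell s g then Z s g else 0.

Lemma cut_supported Z : supported (cut Z).
Proof. by move=> s g; rewrite /cut => /negPf->. Qed.

(** Here and in the next three lemmas, for strings and gaps in all combinations: between a valid
    cell and a valid face obtained by two deletions, the intermediate face is valid. *)
Lemma vcell_ss s1 i s2 t1 j t2 g :
    vcell (s1 ++ i :: s2) g -> s1 ++ s2 = t1 ++ j :: t2 -> vcell (t1 ++ t2) g ->
  vcell (s1 ++ s2) g.
Proof.
move=> vsg Ds /and5P[t_n0 _ st tn /andP[sg _]].
have s_n0 : s1 ++ s2 != [::] by rewrite Ds; case: (t1).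
rewrite (vcell_sface vsg s_n0); apply: sorted_linkS sg.
have /and5P[_ _ ss sn _] := vsg.
have sub_s : subseq (s1 ++ s2) (s1 ++ i :: s2).
  by rewrite cat_subseq // subseq_cons.
have ss' := subseq_sorted leq_trans sub_s ss.
apply: L_mono; rewrite {1}Ds last_face_le -?Ds //=.
by apply: last_le_n; apply/allP => k /(mem_subseq sub_s)/(allP sn).
Qed.

Lemma vcell_sg s1 i s2 g1 e g2 :
    vcell (s1 ++ i :: s2) (g1 ++ e :: g2) -> diagonal e ->
    vcell (s1 ++ s2) (g1 ++ g2) ->
  vcell (s1 ++ s2) (g1 ++ e :: g2).
Proof.
move=> vsg /eqP De vc; have /and5P[s_n0 g_n0 ss sn /andP[sg /and3P[uL vL _]]] :=
  vc.
rewrite (vcell_sface vsg s_n0).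
have /and5P[_ _ ss0 sn0 /andP[sg0 /and3P[uL0 vL0 _]]] := vsg.
have lehn : (last 0 (s1 ++ s2) <= n)%N := last_le_n sn.
have /subsetP sub_L := L_head_last ss sn.
have {}uL := sub_L _ uL.
have {}vL := sub_L _ vL.
have {}vL0 : (last e0 (g1 ++ e :: g2)).2 \in L (last 0%N (s1 ++ s2)).
  apply/(subsetP _ _ vL0)/L_mono; rewrite last_le_n // andbT.
  exact: leq_trans (head_face_ge ss0 s_n0) (head_le_last ss).
have subM x y : x \in L (last 0%N (s1 ++ s2)) -> y \subset x -> y != set0 ->
  y \in L (last 0%N (s1 ++ s2)) by apply: L_sub.
have M0n0 x : x \in L (last 0%N (s1 ++ i :: s2)) -> x != set0.
  by apply: L_n0; apply: last_le_n.
move: {vc} g_n0 sg sg0 uL vL uL0 vL0; set M := L _ in subM *;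
  set M0 := L _ in M0n0 *.
case/lastP: g1 {vsg} => [|h d].
  case: g2 => [|f h2] //= _ sf /andP[/and3P[eL fL ef] _] fL' _ _ _.
  by rewrite sf andbT /link /face_pair fL' ef (subM _ _ fL') // (M0n0 _ eL).
rewrite !last_cat !cat_rcons !sorted_cat_cons last_rcons /=.
move=> _; case: g2 => [|f h2] /=.
  rewrite !andbT => sd /andP[_ /and3P[_ eL de]] _ dL _ eL'.
  by rewrite sd /link /face_pair dL De eL' -De de.
move=> /andP[sd /andP[/and3P[dL fL _] sf]] /and3P[_ /and3P[_ eL de]].
move=> /andP[/and3P[_ _ ef] _] _ _ _ _.
have e1L : e.1 \in M by rewrite De (subM _ _ fL) // -De M0n0.
by rewrite sd sf /link /face_pair dL fL -De e1L de De ef.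
Qed.

Lemma vcell_gs s1 i s2 g1 e g2 :
    vcell (s1 ++ i :: s2) (g1 ++ e :: g2) -> diagonal e ->
    vcell (s1 ++ s2) (g1 ++ g2) ->
  vcell (s1 ++ i :: s2) (g1 ++ g2).
Proof.
move=> vsg de /and5P[_ g_n0 _ _ /andP[_ /and3P[_ _ uv]]].
by rewrite (vcell_gface vsg de g_n0).
Qed.

Lemma vcell_gg s g1 e g2 h1 f h2 :
    vcell s (g1 ++ e :: g2) -> diagonal e -> g1 ++ g2 = h1 ++ f :: h2 ->
    diagonal f -> vcell s (h1 ++ h2) ->
  vcell s (g1 ++ g2).
Proof.
move=> vsg de Dg df /and5P[_ h_n0 _ _ /andP[_ /and3P[_ _ uv]]].
have g_n0 : g1 ++ g2 != [::] by rewrite Dg; case: (h1).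
rewrite (vcell_gface vsg de g_n0).
have /and5P[_ _ _ _ /andP[sg _]] := vsg.
have [sg' _ _] := sorted_link_face de sg.
rewrite Dg in sg' *; have [_ uu vv] := sorted_link_face df sg'.
exact: subset_trans (uu h_n0) (subset_trans uv (vv h_n0)).
Qed.

(** At an invalid face of a valid cell the coboundary already vanishes, since by the four preceding
    lemmas all faces it involves are invalid. Truncation thus changes nothing and [dcell_dcell]
    applies. *)
Lemma dcell_cut_dcell Z s g : supported Z -> vcell s g ->
  dcell (cut (dcell Z)) s g = 0.
Proof.
move=> suppZ vsg; rewrite -(dcell_dcell Z s g).
have dcell0 t h :
    (forall t1 i t2, t = t1 ++ i :: t2 -> ~~ vcell (t1 ++ t2) h) ->
    (forall h1 e h2, h = h1 ++ e :: h2 -> diagonal e ->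
      ~~ vcell t (h1 ++ h2)) ->
  dcell Z t h = 0.
  move=> nvs nvg; rewrite (@eq_dcell _ _ _ _ (fun _ _ => 0)).
  - by rewrite /dcell !delta_face0 // mulr0 addr0.
  - by move=> t1 i t2 /nvs/suppZ.
  - by move=> h1 e h2 /nvg/[apply]/suppZ.
apply: eq_dcell => [s1 i s2 Ds | g1 e g2 Dg de]; rewrite /cut.
  case: ifPn => // nv; rewrite Ds in vsg; rewrite dcell0 //.
    by move=> t1 j t2 Dt; apply: contra nv; apply: vcell_ss vsg Dt.
  move=> h1 f h2 Dh df; apply: contra nv; rewrite Dh in vsg *.
  exact: vcell_sg vsg df.
case: ifPn => // nv; rewrite Dg in vsg; rewrite dcell0 //.
  move=> t1 j t2 Dt; apply: contra nv; rewrite Dt in vsg *.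
  exact: vcell_gs vsg de.
by move=> h1 f h2 Dh df; apply: contra nv; apply: vcell_gg vsg de Dh df.
Qed.


(** By [vcell_diag], validity of an all-diagonal cell sees only the first complex of the string, and
    [n] bounds all indices. *)
Lemma vcell_rcons s g : all (@diagonal _) g -> s != [::] ->
  vcell (rcons s n) g = vcell s g.
Proof.
move=> /diagonalE-> s_n0; rewrite !vcell_diag.
have -> : head 0 (rcons s n) = head 0 s by case: (s) s_n0.
have -> : rcons s n != [::] by rewrite -size_eq0 size_rcons.
rewrite all_rcons leqnn s_n0 !andTb.
apply/and4P/and4P => -[c_n0 ss sn cc]; split=> //.
  by move: ss; rewrite -cats1 => /cat_sorted2[].
by move: ss; rewrite !(sorted_pairwise leq_trans) pairwise_rcons sn => ->.
Qed.

Lemma vcell_double s g1 e g2 :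
  vcell s (g1 ++ (e.1, e.1) :: e :: g2) = vcell s (g1 ++ e :: g2).
Proof.
have g_n0 : g1 ++ e :: g2 != [::] by case: (g1).
have head_eq : (head e0 (g1 ++ (e.1, e.1) :: e :: g2)).1 =
  (head e0 (g1 ++ e :: g2)).1 by case: (g1).
have last_eq : last e0 (g1 ++ (e.1, e.1) :: e :: g2) = last e0 (g1 ++ e :: g2).
  by rewrite !last_cat.
apply/idP/idP => vsg.
  rewrite (vcell_gface vsg) ?/diagonal //= -head_eq -last_eq.
  by have /and5P[_ _ _ _ /andP[_ /and3P[]]] := vsg.
have /and5P[s_n0 _ ss sn /andP[sg bg]] := vsg.
apply/and5P; split=> //; first by case: (g1).
apply/andP; split; last by rewrite head_eq last_eq.
move: sg; rewrite !sorted_cat_cons /= => /andP[sg1 ->]; rewrite andbT.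
have e1L : e.1 \in L (last 0%N s).
  case/lastP: g1 sg1 bg {vsg g_n0 head_eq last_eq} => [_ /and3P[+ _ _]|h d].
    by move/(subsetP (L_head_last ss sn)).
  rewrite -[rcons (rcons h d) e]cats1 cat_rcons sorted_cat_cons /=.
  by case/and3P=> _ /and3P[].
rewrite {2}/link /face_pair e1L subxx /= andbT.
case/lastP: g1 sg1 {vsg g_n0 head_eq last_eq bg} => // h d.
by rewrite -![rcons (rcons h d) _]cats1 !cat_rcons !sorted_cat_cons.
Qed.

(** The homotopy reads [Z] only at cells of the same validity. This gives preservation of support,
    and also lets a cocycle condition known at valid cells alone be used. *)
Lemma cell_htpy_vcell Z s g :
    (forall t h, vcell t h = vcell s g -> Z t h = 0) -> cell_htpy n Z s g = 0.
Proof.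
move=> Z0; rewrite /cell_htpy; case: ifPn => [dg|_].
  have [->|s_n0] := eqVneq s [::]; first by [].
  by rewrite string_htpyE ?lt0n ?size_eq0 // Z0 ?mulr0 // vcell_rcons.
by rewrite gap_htpy_eq0 ?mulr0 // => g1 e g2 Dg; rewrite Z0 // vcell_double Dg.
Qed.

Lemma cell_htpy_supported Z : supported Z -> supported (cell_htpy n Z).
Proof.
move=> suppZ s g nv; apply: cell_htpy_vcell => t h.
by rewrite (negPf nv) => /negbT/suppZ.
Qed.

(** The single index of the string is arbitrary: a nerve cochain of the last complex is restricted
    to every complex of the family, and this compatibility makes it closed in the string
    direction. *)
Definition of_nerve z s g : R :=
  if [&& size s == 1, all (@diagonal _) g & vcell s g] then z (map fst g)
    else 0.

Definition to_nerve Z c := Z [:: n] (diag c).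

Lemma of_nerve_supported z : supported (of_nerve z).
Proof. by move=> s g /negPf vF; rewrite /of_nerve vF !andbF. Qed.

Lemma map_fst_diag c : map fst (diag c) = c.
Proof. by rewrite -map_comp map_id. Qed.

Lemma vcell_top c : vcell [:: n] (diag c) = (c != [::]) && chain (L n) setT c.
Proof. by rewrite vcell_diag /= leqnn. Qed.

Lemma of_nerveK z c : c != [::] -> chain (L n) setT c ->
  to_nerve (of_nerve z) c = z c.
Proof.
move=> c_n0 cc.
by rewrite /to_nerve /of_nerve /= all_diag vcell_top c_n0 cc map_fst_diag.
Qed.

Lemma delta_diag (X : seq (face * face) -> R) c :
  delta (@diag_wt R _) X (diag c) = delta (fun=> 1) (X \o diag) c.
Proof.
rewrite /diag delta_map.
by apply: eq_delta_wt => x; rewrite /diag_wt /diagonal /= eqxx.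
Qed.

Lemma to_nerve_delta Z c : supported Z ->
  delta (fun=> 1) (to_nerve Z) c = to_nerve (dcell Z) c.
Proof.
move=> suppZ; rewrite /to_nerve /dcell /= suppZ // mulr0 subrr add0r.
by rewrite expr2 mulrNN !mulr1 mul1r delta_diag.
Qed.

(** On a string of two indices the two deletions give the same value with opposite signs. The
    condition at [[::]] matches the fact that [of_nerve] vanishes on an empty gap list. *)
Lemma dcell_of_nerve z s g : z [::] = 0 -> vcell s g ->
  dcell (of_nerve z) s g = of_nerve (delta (fun=> 1) z) s g.
Proof.
move=> z0 vsg.
have nd0 z' t h : ~~ all (@diagonal _) h -> of_nerve z' t h = 0.
  by rewrite /of_nerve => /negPf->; rewrite andbF.
have ns0 z' t h : size t != 1 -> of_nerve z' t h = 0.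
  by rewrite /of_nerve => /negPf->.
have [dg|ndg] := boolP (all (@diagonal _) g); last first.
  rewrite nd0 // (@eq_dcell _ _ _ _ (fun _ _ => 0)).
  - by rewrite /dcell !delta_face0 // mulr0 addr0.
  - by move=> *; apply: nd0.
  - move=> g1 e g2 Dg de; apply: nd0; apply: contra ndg.
    by rewrite Dg !all_cat /= de.
have [sz1|sz1] := eqVneq (size s) 1.
  case: s sz1 vsg => [|i [|? ?]] // _ vsg; rewrite /dcell /=.
  rewrite mul1r subr0 ns0 // add0r expr2 mulrNN mulr1 mul1r.
  rewrite [RHS]/of_nerve dg vsg /=.
  rewrite {1}(diagonalE dg) delta_diag; apply: eq_delta_face => c1 x c2 Dc _ /=.
  rewrite /of_nerve /= all_diag map_fst_diag vcell_diag /=.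
  have [->|c_n0] := eqVneq (c1 ++ c2) [::]; first by rewrite z0.
  rewrite (diagonalE dg) vcell_diag in vsg.
  have /and5P[_ _ _ /= -> cc] := vsg; rewrite ifT //=.
  by apply: chain_face cc; rewrite Dc cat_subseq // subseq_cons.
rewrite ns0 // /dcell [X in _ + _ * X]delta_face0 => [|*]; last exact: ns0.
rewrite mulr0 addr0; have [sz2|sz2] := eqVneq (size s) 2; last first.
  apply: delta_face0 => s1 i s2 Ds _; apply: ns0; apply: contra sz2.
  by rewrite Ds !size_cat /= addnS.
case: s sz2 {sz1} vsg => [|i [|j [|? ?]]] // _ vsg.
rewrite /= !mul1r !subr0 /of_nerve /= dg.
have v2 : vcell [:: i] g.
  rewrite (diagonalE dg) !vcell_diag /= in vsg *.
  by case/and4P: vsg => -> _ /andP[-> _] ->.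
rewrite v2 (vcell_sface (s1 := [::]) vsg) //.
by have /and5P[_ _ _ _ /andP[-> _]] := vsg; rewrite subrr.
Qed.

(** The cell homotopy moves [Z] onto the string [[:: n]], the nerve homotopy replaces the result by
    its simplicial retraction; [W] is the sum of the two primitives. *)
Lemma cocycle_of_nerve Z : supported Z ->
    (forall s g, vcell s g -> dcell Z s g = 0) ->
  exists2 W, supported W & forall s g, vcell s g ->
    Z s g = dcell W s g + of_nerve (simp_retract (to_nerve Z)) s g.
Proof.
move=> suppZ dZ0; set z := to_nerve Z; set y := nerve_htpy z.
exists (fun s g => cell_htpy n Z s g + of_nerve y s g) => [s g nv|s g vsg].
  by rewrite of_nerve_supported // cell_htpy_supported // addr0.
have s_gt0 : (0 < size s)%N by rewrite lt0n size_eq0; case/and5P: vsg.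
have -> : dcell (fun s g => cell_htpy n Z s g + of_nerve y s g) s g =
    dcell (cell_htpy n Z) s g + dcell (of_nerve y) s g.
  by rewrite /dcell !deltaD; ring.
have := cell_htpy_dcell n Z g s_gt0.
rewrite [cell_htpy n (dcell Z) s g]cell_htpy_vcell => [|t h]; last first.
  by rewrite vsg; apply: dZ0.
rewrite addr0 => ->; rewrite dcell_of_nerve // -addrA.
have -> : of_nerve (delta (fun=> 1) y) s g + of_nerve (simp_retract z) s g =
   if (size s == 1) && all (@diagonal _) g then Z [:: n] g else 0.
  rewrite /of_nerve vsg andbT; case: ifP => [/andP[/eqP sz1 dg]|];
    last by rewrite addr0.
  set c := map fst g; have Dg : g = diag c by apply: diagonalE.
  have cc : chain (L n) setT c.
    move: vsg; rewrite Dg vcell_diag; case: (s) sz1 => [|i [|? ?]] //= _.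
    rewrite andbT; case/and3P=> _ lein /andP[sc /allP ac].
    apply/andP; split=> //; apply/allP => x /ac/andP[xL ->]; rewrite andbT.
    by apply/(subsetP _ _ xL)/L_mono; rewrite lein leqnn.
  rewrite -[Z _ _](_ : z c = _); last by rewrite /z /to_nerve -Dg.
  rewrite -[z c](subrK (simp_retract z c)) -(nerve_htpy_delta _ cc).
  congr (_ + _); rewrite -[LHS]add0r; congr (_ + _).
  (* The coboundary of [to_nerve Z] is known to vanish only on nonempty chains of the last complex;
     the carrier condition makes this enough. *)
  apply/esym; rewrite -[RHS](nerve_htpy0 R c).
  apply: eq_nerve_htpy (L_simpcomp (leqnn n)) _ cc => d cd sz_d.
  rewrite to_nerve_delta // /to_nerve dZ0 // vcell_top cd andbT.
  by rewrite -size_eq0 sz_d.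
by rewrite subrK.
Qed.

End NestedCells.

(** * Linear algebra of spans and quotients *)

(** The differentials of the statement are bare functions inside [linfun], which agrees with its
    argument only once linearity is proved. *)
Lemma linfun_linearE (k : fieldType) (U V : vectType k) (h : U -> V) :
  linear h -> linfun h =1 h.
Proof.
move=> h_lin; pose hL := GRing.isLinear.Build k U V *:%R h h_lin.
exact: (lfunE (HB.pack h hL : {linear U -> V})).
Qed.

Lemma mem_span_indicators (k : fieldType) (T : finType) (A : {pred T})
    (h : {ffun T -> k^o}) :
  h \in <<[seq [ffun x : T => ((x == j)%:R : k^o)] | j <- enum A]>>%VS <->
  (forall x, x \notin A -> h x = 0).
Proof.
set X := map _ _; split=> [Xh x nAx|h0].
  rewrite (coord_span (X := in_tuple X) Xh) sum_ffunE big1 // => i _.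
  have : X`_i \in X by rewrite mem_nth.
  case/mapP=> j; rewrite mem_enum => Aj ->; rewrite !ffunE.
  by have [Dx|_] := eqVneq; [rewrite Dx Aj in nAx | rewrite scaler0].
have -> : h = \sum_(j in A) h j *: [ffun x : T => ((x == j)%:R : k^o)].
  apply/ffunP => x; rewrite sum_ffunE; have [Ax|nAx] := boolP (x \in A).
    rewrite (bigD1 x) //= !ffunE eqxx [_ *: 1]mulr1 big1 ?addr0 // =>
      j /andP[_ jx].
    by rewrite !ffunE eq_sym (negPf jx) scaler0.
  rewrite h0 // big1 // => j Aj; rewrite !ffunE.
  by have [Dx|_] := eqVneq; [rewrite Dx Aj in nAx | rewrite scaler0].
apply: memv_suml => j Aj; apply/memvZ/memv_span/map_f.
by rewrite mem_enum.
Qed.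

(** [G] is injective on [ZB], [ZA] is the sum of [BA] and [G @: ZB], and these two meet in
    [G @: BB]; the dimension formula concludes. *)
Lemma dimv_quotient_eq (k : fieldType) (U V : vectType k)
    (ZA BA : {vspace U}) (ZB BB : {vspace V}) (F : U -> V) (G : 'Hom(V, U)) :
    (BA <= ZA)%VS -> (BB <= ZB)%VS ->
    (forall a, a \in ZA -> F a \in ZB) -> (forall a, a \in BA -> F a \in BB) ->
    (forall b, b \in ZB -> G b \in ZA) -> (forall b, b \in BB -> G b \in BA) ->
    (forall b, b \in ZB -> F (G b) = b) ->
    (forall a, a \in ZA -> a - G (F a) \in BA) ->
  (\dim ZA - \dim BA = \dim ZB - \dim BB)%N.
Proof.
move=> sBZA sBZB FZ FB GZ GB FGK GFK.
have dimG W : (W <= ZB)%VS -> \dim (G @: W) = \dim W.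
  move=> sWZ; apply: limg_dim_eq; apply/eqP; rewrite -subv0.
  apply/subvP => b; rewrite memv_cap memv_ker =>
    /andP[/(subvP sWZ) Zb /eqP Gb0].
  have F0 : F 0 = 0.
    by rewrite -[in F 0](linear0 G) FGK ?mem0v.
  by rewrite -(FGK b Zb) Gb0 F0 mem0v.
have ZAE : ZA = (BA + G @: ZB)%VS.
  apply/eqP; rewrite eqEsubv; apply/andP; split; last first.
    rewrite subv_add sBZA; apply/subvP => _ /memv_imgP[b Zb ->].
    exact: GZ.
  apply/subvP => a Za; rewrite -[a](subrK (G (F a))) memv_add ?GFK //.
  exact/memv_img/FZ.
have capE : (BA :&: G @: ZB)%VS = (G @: BB)%VS.
  apply/eqP; rewrite eqEsubv; apply/andP; split.
    apply/subvP => a; rewrite memv_cap => /andP[Ba /memv_imgP[b Zb Da]].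
    by rewrite Da memv_img // -(FGK b Zb) -Da FB.
  apply/subvP => _ /memv_imgP[b Bb ->]; rewrite memv_cap GB //.
  exact/memv_img/(subvP sBZB).
have := dimv_sum_cap BA (G @: ZB); rewrite -ZAE capE !dimG //.
have := dimvS sBZA; have := dimvS sBZB; lia.
Qed.

(** * Simplicial cochains as functions of sorted vertex lists *)

Section OrderedSimplices.
Variables (k : fieldType) (N : nat).
Local Notation face := {set 'I_N}.
Implicit Types (s : face) (v : seq nat) (y : {ffun face -> k^o}).

Definition vlist s : seq nat := map val (vsorted s).

Lemma mem_vsorted s i : (i \in vsorted s) = (i \in s).
Proof. by rewrite mem_sort mem_enum. Qed.

Lemma vsorted_uniq s : uniq (vsorted s).
Proof. by rewrite sort_uniq enum_uniq. Qed.

Lemma size_vlist s : size (vlist s) = #|s|.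
Proof. by rewrite size_map size_sort -cardE. Qed.

Lemma vlist_lt s : all (ltn^~ N) (vlist s).
Proof. by rewrite all_map; apply/allP => i _; apply: ltn_ord. Qed.

Lemma vlist_sorted s : sorted ltn (vlist s).
Proof.
rewrite ltn_sorted_uniq_leq map_inj_uniq ?vsorted_uniq; last exact: val_inj.
rewrite sorted_map; apply: sort_sorted => i j; apply: leq_total.
Qed.

Lemma vlistK s : vset N (vlist s) = s.
Proof.
by apply/setP => i; rewrite inE mem_map ?mem_vsorted //; apply: val_inj.
Qed.

Lemma vsetK v : sorted ltn v -> all (ltn^~ N) v -> vlist (vset N v) = v.
Proof.
move=> sv /allP ltv; apply: (irr_sorted_eq ltn_trans ltnn) => //.
  exact: vlist_sorted.
move=> i; apply/mapP/idP => [[j +] ->|vi].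
  by rewrite mem_vsorted inE.
by exists (Ordinal (ltv i vi)); rewrite // mem_vsorted inE.
Qed.

Lemma card_vset v : sorted ltn v -> all (ltn^~ N) v -> #|vset N v| = size v.
Proof. by move=> sv ltv; rewrite -size_vlist vsetK. Qed.

Lemma coboundE (S : {set face}) q y s : s \in simplices S q.+1 ->
  cobound S q y s = delta (fun=> 1) (y \o @vset N) (vlist s).
Proof.
move=> Ss; rewrite ffunE Ss (deltaE _ _ _ 0%N) size_map -big_enum /=.
rewrite -(perm_big _ (permEl (perm_sort (fun i j : 'I_N => (i <= j)%N) _))) /=.
rewrite -/(vsorted s); case Ds: (vsorted s) => [|i0 s'];
  first by rewrite big_nil big_ord0.
rewrite -Ds (big_nth i0) big_mkord; apply: eq_bigr => i _.
rewrite index_uniq ?vsorted_uniq // mulr1; congr (_ * y _).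
apply/setP => j; rewrite !inE.
have Ed : drop i (vsorted s) = nth i0 (vsorted s) i :: drop i.+1 (vsorted s).
  exact: drop_nth.
have Es : vsorted s =
    take i (vsorted s) ++ nth i0 (vsorted s) i :: drop i.+1 (vsorted s).
  by rewrite -Ed cat_take_drop.
have := vsorted_uniq s; rewrite {1}Es -mem_vsorted.
have -> : (j \in vsorted s) = [|| j \in take i (vsorted s),
    j == nth i0 (vsorted s) i | j \in drop i.+1 (vsorted s)].
  by rewrite {1}Es mem_cat inE.
have -> : take i (vlist s) ++ drop i.+1 (vlist s) =
    map val (take i (vsorted s) ++ drop i.+1 (vsorted s)).
  by rewrite map_cat map_take map_drop.
rewrite mem_map; last exact: val_inj.
rewrite cat_uniq mem_cat /= => /and3P[_ /norP[nt _] /andP[nd _]].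
have [->|] := eqVneq j (nth i0 (vsorted s) i) => //=.
by rewrite (negPf nt) (negPf nd).
Qed.

End OrderedSimplices.

(** * Tuples of intervals as lists of gaps *)

Section GapList.
Variable T : eqType.
Implicit Types (x y u v : T) (ts : seq (T * T)).

Fixpoint gap_list u ts v : seq (T * T) :=
  if ts is t :: ts' then (u, t.1) :: gap_list t.2 ts' v else [:: (u, v)].

Lemma size_gap_list u ts v : size (gap_list u ts v) = (size ts).+1.
Proof. by elim: ts u => //= t ts IHts u; rewrite IHts. Qed.

Lemma head_gap_list e u ts v : (head e (gap_list u ts v)).1 = u.
Proof. by case: ts. Qed.

Lemma last_gap_list e u ts v : (last e (gap_list u ts v)).2 = v.
Proof. by elim: ts u e => //= t ts IHts u e. Qed.

Lemma sorted_gap_list (r : rel T) u ts v :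
  sorted (fun d e => r d.2 e.1) (gap_list u ts v) = all (fun t => r t.1 t.2) ts.
Proof.
by elim: ts u => // t ts IHts u; rewrite [RHS]/= -(IHts t.2); case: (ts).
Qed.

Lemma gap_list_inj u ts v u' ts' v' :
  gap_list u ts v = gap_list u' ts' v' -> [/\ u = u', ts = ts' & v = v'].
Proof.
elim: ts u u' ts' => [|[x y] ts IHts] u u' [|[x' y'] ts'] //=.
- by case.
- by move=> /(congr1 size)/=; rewrite size_gap_list.
- by move=> /(congr1 size)/=; rewrite size_gap_list.
- by case=> -> -> /IHts[-> -> ->].
Qed.

Lemma gap_list_surj g : g != [::] ->
  exists u ts v, g = gap_list u ts v.
Proof.
elim: g => // -[u x] [|e g] IHg _; first by exists u, [::], x.
have [//|y [ts [v Dg]]] := IHg; exists u, ((x, y) :: ts), v.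
by rewrite Dg.
Qed.

(** The product of two adjacent tensor factors. Composability is not tested: it is the diagonality
    of the gap between them. *)
Definition merge_at d0 l ts : seq (T * T) :=
  take l ts ++ ((nth d0 ts l).1, (nth d0 ts l.+1).2) :: drop l.+2 ts.

Lemma gap_list_merge d0 e0 u ts v l : (l.+1 < size ts)%N ->
  nth e0 (gap_list u ts v) l.+1 = ((nth d0 ts l).2, (nth d0 ts l.+1).1)
  /\ take l.+1 (gap_list u ts v) ++ drop l.+2 (gap_list u ts v) =
     gap_list u (merge_at d0 l ts) v.
Proof.
elim: ts u l => [|t [|t' ts] IHts] u [|l] //= lt_l.
  by rewrite /merge_at /= !drop0.
have [En Eg] := IHts t.2 l lt_l; split; first exact: En.
by congr (_ :: _); exact: Eg.
Qed.

Lemma nth_merge_at d0 l ts i : (l.+1 < size ts)%N ->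
  nth d0 (merge_at d0 l ts) i =
  if (i < l)%N then nth d0 ts i
  else if i == l then ((nth d0 ts l).1, (nth d0 ts l.+1).2)
  else nth d0 ts i.+1.
Proof.
move=> lt_l; have szl : size (take l ts) = l by rewrite size_takel //; lia.
rewrite nth_cat szl; case: ltnP => [lt_il|le_li]; first by rewrite nth_take.
case: eqVneq => [->|ne_il]; first by rewrite subnn.
have -> : (i - l = (i - l).-1.+1)%N by lia.
by rewrite /= nth_drop; congr nth; lia.
Qed.

Lemma size_merge_at d0 l ts : (l.+1 < size ts)%N ->
  size (merge_at d0 l ts) = (size ts).-1.
Proof.
move=> lt_l; rewrite size_cat size_takel /=; last by lia.
by rewrite size_drop; lia.
Qed.

Lemma gap_list_last d0 u ts v l : (l.+1 = size ts)%N ->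
  nth d0 (gap_list u ts v) l.+1 = ((nth d0 ts l).2, v)
  /\ take l.+1 (gap_list u ts v) = gap_list u (take l ts) (nth d0 ts l).1.
Proof.
elim: ts u l => [|t [|t' ts] IHts] u [|l] //= [sz_l].
have [En Eg] := IHts t.2 l (congr1 _ sz_l); split; first exact: En.
by congr (_ :: _); exact: Eg.
Qed.

End GapList.

(** * Embedding the filtration into its last complex *)

Section Embedding.
Variables (N n : nat) (S : nat -> {set {set 'I_N}}) (f : nat -> 'I_N -> 'I_N).
Hypothesis hS : forall i, (i <= n)%N -> is_simpcomp (S i).
Hypothesis hf : forall i, (i < n)%N -> inj_simp_map (S i) (S i.+1) (f i).
Local Notation face := {set 'I_N}.
Implicit Types (x y : face).

Lemma fcompD i d d' v : fcomp f i (d + d') v =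
  fcomp f (i + d) d' (fcomp f i d v).
Proof. by elim: d' => [|d' IHd]; rewrite ?addn0 // addnS /= IHd addnA. Qed.

Definition push i j x : face := fmap f i j @: x.

Lemma push_id i x : push i i x = x.
Proof. by rewrite /push /fmap subnn imset_id. Qed.

Lemma push_comp i j l x : (i <= j <= l)%N -> push j l (push i j x) = push i l x.
Proof.
move=> /andP[le_ij le_jl]; rewrite /push -imset_comp; apply: eq_imset => v /=.
rewrite /fmap; have -> : (l - i = (j - i) + (l - j))%N by lia.
by rewrite fcompD subnKC.
Qed.

Lemma pushS i x : push i i.+1 x = f i @: x.
Proof.
by rewrite /push /fmap subSnn; apply: eq_imset => v /=; rewrite addn0.
Qed.

Lemma push_mem i j x : (i <= j <= n)%N -> x \in S i -> push i j x \in S j.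
Proof.
move=> /andP[le_ij]; rewrite -(subnKC le_ij);
  elim: (j - i)%N => [|d IHd] le_n xS.
  by rewrite addn0 push_id.
rewrite addnS in le_n *; rewrite -(@push_comp _ (i + d)) ?leq_addr ?leqnSn //.
by rewrite pushS; apply: (proj1 (hf le_n)); apply: IHd => //; apply: ltnW.
Qed.

Lemma fmap_inj i j : (i <= j <= n)%N ->
  {in verts (S i) &, injective (fmap f i j)}.
Proof.
move=> /andP[le_ij le_jn]; rewrite /fmap.
have: (i + (j - i) <= n)%N by rewrite subnKC.
elim: (j - i)%N => [_ u v _ _ //|d IHd le_n u v uS vS /=].
rewrite addnS in le_n; have le_idn := ltnW le_n.
have vertsS w : w \in verts (S i) -> fcomp f i d w \in verts (S (i + d)).
  case/bigcupP=> x xS wx; apply/bigcupP; exists (push i (i + d) x).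
    by rewrite push_mem // leq_addr.
  by rewrite /push /fmap addKn imset_f.
by move/(proj2 (hf le_n)) => E; apply: IHd => //; apply: E; apply: vertsS.
Qed.

Lemma push_sub i j x y : (i <= j <= n)%N -> x \in S i -> y \in S i ->
  (push i j x \subset push i j y) = (x \subset y).
Proof.
move=> le_ijn xS yS; apply/idP/idP => [/subsetP sub_xy|]; last exact: imsetS.
have in_verts z v : z \in S i -> v \in z -> v \in verts (S i).
  by move=> zS vz; apply/bigcupP; exists z.
apply/subsetP => v vx; have /imsetP[w wy Evw] := sub_xy _ (imset_f _ vx).
by rewrite (fmap_inj le_ijn _ _ Evw) //;
  [apply: in_verts vx | apply: in_verts wy].
Qed.

Lemma push_inj i j : (i <= j <= n)%N -> {in S i &, injective (push i j)}.
Proof.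
move=> le_ijn x y xS yS Exy; apply/eqP.
by rewrite eqEsubset -(push_sub le_ijn xS yS) -(push_sub le_ijn yS xS) Exy
  subxx.
Qed.

Definition image_cpx i : {set face} := [set push i n x | x in S i].

Lemma image_cpx_mem i x : x \in S i -> push i n x \in image_cpx i.
Proof. exact: imset_f. Qed.

Lemma image_cpx_top : image_cpx n = S n.
Proof.
rewrite /image_cpx -[RHS]imset_id; apply: eq_imset => x; exact: push_id.
Qed.

Lemma image_cpx_simpcomp i : (i <= n)%N -> is_simpcomp (image_cpx i).
Proof.
move=> le_in; have [S0 Sdown] := hS le_in; split.
  apply/imsetP => -[x xS /esym/eqP]; rewrite imset_eq0 => /eqP x0.
  by rewrite x0 (negPf S0) in xS.
move=> _ t /imsetP[x xS ->] sub_t t_n0.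
have Et : t = push i n [set v in x | fmap f i n v \in t].
  apply/setP => w; apply/idP/imsetP => [wt|[v]].
    have /imsetP[v vx Ew] := subsetP sub_t _ wt.
    by exists v => //; rewrite inE vx -Ew.
  by rewrite inE => /andP[_ vt ->].
rewrite Et; apply: image_cpx_mem; apply: Sdown xS _ _.
  by apply/subsetP => v; rewrite inE => /andP[].
by apply: contraNneq t_n0 => E; rewrite Et E /push imset0.
Qed.

Lemma image_cpx_mono i j : (i <= j <= n)%N -> image_cpx i \subset image_cpx j.
Proof.
move=> le_ijn; apply/subsetP => _ /imsetP[x xS ->].
by rewrite -(push_comp x le_ijn) image_cpx_mem // push_mem.
Qed.

Lemma face_pair_push i x y : (i <= n)%N -> x \in S i -> y \in S i ->
  face_pair (image_cpx i) (push i n x) (push i n y) = (x \subset y).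
Proof.
move=> le_in xS yS; rewrite /face_pair !image_cpx_mem //= push_sub //.
by rewrite le_in leqnn.
Qed.

(** Decides inside the last complex whether a face comes from an earlier one; this is how a
    vanishing restriction is recognised as an invalid cell. *)
Lemma push_lift i j x : (i <= j <= n)%N -> x \in S j ->
  push j n x \in image_cpx i -> exists2 x0, x0 \in S i & push i j x0 = x.
Proof.
move=> le_ijn xS /imsetP[x0 x0S Ex]; exists x0 => //.
have le_jn : (j <= n <= n)%N by rewrite leqnn andbT; case/andP: le_ijn.
apply: (push_inj le_jn) => //; first exact: push_mem.
by rewrite Ex push_comp.
Qed.

End Embedding.

(** * Bijection between cochain indices and valid cells *)

Lemma map_inj_all (T1 : eqType) (T2 : Type) (A : {pred T1}) (h : T1 -> T2) s t :
    {in A &, injective h} -> all (mem A) s -> all (mem A) t ->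
  map h s = map h t -> s = t.
Proof.
move=> h_inj; elim: s t => [|x s IHs] [|y t] //= /andP[Ax As] /andP[Ay At].
by case=> /h_inj-> // /IHs->.
Qed.

Section CellsOfIndices.
Variables (k : fieldType) (N n : nat).
Variables (S : nat -> {set {set 'I_N}}) (f : nat -> 'I_N -> 'I_N).
Hypothesis hS : forall i, (i <= n)%N -> is_simpcomp (S i).
Hypothesis hf : forall i, (i < n)%N -> inj_simp_map (S i) (S i.+1) (f i).
Local Notation face := {set 'I_N}.
Local Notation PT := (face * face)%type.
Local Notation L := (image_cpx n S f).
Implicit Types (sg : nat -> 'I_n.+1) (ts : seq PT) (b : PT).
Implicit Types (Z : seq nat -> seq PT -> k) (s : seq nat) (g : seq PT).

Definition push_pair i j (u : PT) : PT := (push f i j u.1, push f i j u.2).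

Definition string p sg : seq nat := mkseq (fun l => val (sg l)) p.+1.

(** The tuple lives in the complex at [sg p], the coefficient pair in the one at [sg 0]; only after
    pushing both to [n] can their ends be compared. *)
Definition gaps p sg ts b : seq PT :=
  gap_list (push f (sg 0%N) n b.1) (map (push_pair (sg p) n) ts)
           (push f (sg 0%N) n b.2).

Definition valid_data p sg ts b :=
  [&& sorted leq (string p sg), all (mem (Bas S (sg p))) ts
    & b \in Bas S (sg 0%N)].

Arguments string : simpl never.

Lemma size_string p sg : size (string p sg) = p.+1.
Proof. exact: size_mkseq. Qed.

Lemma string_n0 p sg : string p sg != [::].
Proof. by rewrite -size_eq0 size_string. Qed.

Lemma nth_string p sg i : (i <= p)%N -> nth 0%N (string p sg) i = sg i.
Proof. by move=> le_ip; rewrite nth_mkseq. Qed.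

Lemma head_string p sg : head 0%N (string p sg) = sg 0%N.
Proof. by rewrite -nth0 nth_string. Qed.

Lemma last_string p sg : last 0%N (string p sg) = sg p.
Proof. by rewrite -nth_last size_string nth_string. Qed.

Lemma string_le_n p sg : all (leq^~ n) (string p sg).
Proof. by apply/allP => _ /mapP[l _ ->]; rewrite -ltnS ltn_ord. Qed.

Lemma eq_string p sg sg' : (forall l, (l <= p)%N -> sg l = sg' l) ->
  string p sg = string p sg'.
Proof.
move=> eq_sg; apply/eq_in_map => l; rewrite mem_iota /= => lt_lp.
by rewrite eq_sg.
Qed.

Lemma sorted_string p sg :
  reflect (forall i, (i < p)%N ->
    (sg i <= sg i.+1)%N) (sorted leq (string p sg)).
Proof.
apply: (iffP (sortedP 0%N)) => le_sg i lt_ip.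
  have := le_sg i; rewrite size_string ltnS => /(_ lt_ip).
  by rewrite (nth_string sg (ltnW lt_ip)) (nth_string sg lt_ip).
rewrite size_string ltnS in lt_ip.
by rewrite (nth_string sg (ltnW lt_ip)) (nth_string sg lt_ip) le_sg.
Qed.

Lemma mem_Bas i (u : PT) :
  (u \in Bas S i) = [&& u.1 \in S i, u.2 \in S i & u.1 \subset u.2].
Proof. by rewrite inE. Qed.

Lemma face_pair_Bas i (u : PT) : (i <= n)%N ->
  u \in Bas S i -> face_pair (L i) (push f i n u.1) (push f i n u.2).
Proof.
by move=> le_in; rewrite mem_Bas => /and3P[xS yS xy];
  rewrite (face_pair_push hf).
Qed.

Lemma vcell_gap_list s u ts v :
  vcell n L s (gap_list u ts v) =
  [&& s != [::], sorted leq s, all (leq^~ n) s,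
      all (fun t => face_pair (L (last 0%N s)) t.1 t.2) ts
    & face_pair (L (head 0%N s)) u v].
Proof.
rewrite /vcell (sorted_gap_list (face_pair (L (last 0%N s)))).
by rewrite head_gap_list last_gap_list -[gap_list _ _ _ == _]size_eq0
  size_gap_list.
Qed.

Lemma vcell_gaps p sg ts b :
  valid_data p sg ts b -> vcell n L (string p sg) (gaps p sg ts b).
Proof.
case/and3P=> ss /allP tsB bB; rewrite vcell_gap_list ss string_le_n string_n0
  last_string head_string /=.
rewrite face_pair_Bas ?andbT // -1?ltnS //.
rewrite all_map; apply/allP => t /tsB tB; apply: face_pair_Bas tB.
by rewrite -ltnS.
Qed.

Lemma val_le_n (i : 'I_n.+1) : (i <= n)%N.
Proof. by rewrite -ltnS. Qed.
Hint Resolve val_le_n : core.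

Lemma push_pair_Bas i j u :
  (i <= j <= n)%N -> u \in Bas S i -> push_pair i j u \in Bas S j.
Proof.
move=> le_ijn; rewrite !mem_Bas => /and3P[xS yS xy] /=.
by rewrite !(push_mem hf) //= imsetS.
Qed.

Lemma push_pair_inj i j :
  (i <= j <= n)%N -> {in Bas S i &, injective (push_pair i j)}.
Proof.
move=> le_ijn [x y] [x' y']; rewrite !mem_Bas /=.
move=> /and3P[xS yS _] /and3P[x'S y'S _] [Ex Ey].
by congr pair; apply: (push_inj hf le_ijn).
Qed.

Lemma push_pair_comp i j u : (i <= j <= n)%N ->
  push_pair j n (push_pair i j u) = push_pair i n u.
Proof. by move=> le_ijn; rewrite /push_pair /= !push_comp. Qed.

Lemma push_pair_lift i u v : (i <= n)%N -> face_pair (L i) u v ->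
  exists2 b, b \in Bas S i & push_pair i n b = (u, v).
Proof.
move=> le_in /and3P[/imsetP[x xS ->] /imsetP[y yS ->]].
rewrite (push_sub hf) ?le_in ?leqnn // => xy.
by exists (x, y); rewrite // mem_Bas xS yS.
Qed.

Lemma push_pairs_lift i ts : (i <= n)%N ->
    all (fun t => face_pair (L i) t.1 t.2) ts ->
  exists2 ts0, all (mem (Bas S i)) ts0 & map (push_pair i n) ts0 = ts.
Proof.
move=> le_in; elim: ts => [|[u v] ts IHts] /=; first by exists [::].
case/andP=> /(push_pair_lift le_in)[b bB <-] /IHts[ts0 tsB <-].
by exists (b :: ts0); rewrite //= bB.
Qed.

Section Indices.
Variable m : nat.
Implicit Types (j : J N n m) (G : {ffun J N n m -> k^o}).

Definition stringJ j := string j.1.1.1 (fun l => j.1.1.2 (inord l)).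
Definition tupleJ j : seq PT := mkseq (fun l => j.1.2 (inord l)) (m - j.1.1.1).
Definition gapsJ j :=
  gaps j.1.1.1 (fun l => j.1.1.2 (inord l)) (tupleJ j) j.2.

Lemma validJE j :
  validJ S j =
  [&& [forall i : 'I_m.+1, (j.1.1.1 < i)%N ==> (j.1.1.2 i == ord0)],
      [forall i : 'I_m.+1, (m - j.1.1.1 <= i)%N ==> (j.1.2 i == defP N)]
    & valid_data j.1.1.1 (fun l => j.1.1.2 (inord l)) (tupleJ j) j.2].
Proof.
rewrite /validJ; set p := j.1.1.1; set sg := j.1.1.2; set t := j.1.2.
have inord0 : inord 0 = ord0 :> 'I_m.+1 by apply: val_inj; rewrite /= inordK.
have inordp : inord p = p by apply: val_inj; rewrite /= inordK.
apply/andP/and3P => [[/andP[/forallP sgP /forallP tP] bB]|[sg0 t0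
  /and3P[ss tB bB]]].
  split; first by apply/forallP => i; have /andP[] := sgP i.
    apply/forallP => i; apply/implyP => le_i.
    by have := tP i; rewrite ltnNge le_i.
  rewrite /valid_data inord0 inordp bB andbT; apply/andP; split.
    apply/sorted_string => i lt_ip; have := sgP (inord i).
    by rewrite inordK ?lt_ip; [case/andP | apply: ltn_trans lt_ip _].
  apply/allP => u /mapP[l]; rewrite mem_iota add0n => /= lt_l Du; rewrite Du.
  have := tP (inord l); rewrite inordK ?lt_l //.
  by apply: leq_trans lt_l _; apply: leq_trans (leq_subr _ _) _.
rewrite inord0 in bB; split=> //; apply/andP; split; apply/forallP => i.
  move/forallP/(_ i): sg0 => sg0; rewrite sg0 /=; apply/implyP => lt_ip.
  by move/sorted_string: ss => /(_ i lt_ip); rewrite inord_val.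
have [lt_i|le_i] := ltnP; last exact: implyP (forallP t0 i) le_i.
rewrite -inordp; apply: (allP tB); apply/mapP; exists (val i).
  by rewrite mem_iota.
by rewrite inord_val.
Qed.

Definition of_cells Z : {ffun J N n m -> k^o} :=
  [ffun j => if validJ S j then Z (stringJ j) (gapsJ j) else 0].

Definition mkJ p sg ts b : J N n m :=
  (inord p, [ffun i : 'I_m.+1 => if (i <= p)%N then sg i else ord0],
   [ffun i : 'I_m.+1 => nth (defP N) ts i], b).

Lemma mkJP p sg ts b : (p <= m)%N -> size ts = (m - p)%N ->
  [/\ validJ S (mkJ p sg ts b) = valid_data p sg ts b,
      stringJ (mkJ p sg ts b) = string p sg
    & gapsJ (mkJ p sg ts b) = gaps p sg ts b].
Proof.
move=> le_pm size_ts; set j := mkJ p sg ts b.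
have p_j : val j.1.1.1 = p by rewrite /= inordK.
have sg_j l : (l <= p)%N -> j.1.1.2 (inord l) = sg l.
  move=> le_lp; have le_lm := leq_trans le_lp le_pm.
  by rewrite ffunE inordK // le_lp.
have string_j : stringJ j = string p sg.
  by rewrite /stringJ p_j; apply: eq_string.
have tuple_j : tupleJ j = ts.
  apply: (@eq_from_nth _ (defP N)); first by rewrite size_mkseq p_j size_ts.
  move=> i; rewrite size_mkseq p_j => lt_i;
    rewrite nth_mkseq ?p_j // ffunE inordK //.
  by apply: leq_trans lt_i _; apply: leq_trans (leq_subr _ _) _.
split=> //; last by rewrite /gapsJ tuple_j p_j /gaps !sg_j.
rewrite validJE tuple_j /valid_data -/(stringJ j) string_j p_j !sg_j //.
rewrite [X in [&& X, _ & _]](_ : _ = true); last first.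
  apply/forallP => i; apply/implyP; rewrite -p_j => lt_pi.
  by rewrite ffunE ifN // -ltnNge -[p]p_j.
rewrite [X in [&& _, X & _]](_ : _ = true) //.
apply/forallP => i; apply/implyP => le_i.
by rewrite ffunE nth_default // size_ts.
Qed.

Lemma getC_of_cells Z p sg ts b : (p <= m)%N -> size ts = (m - p)%N ->
  getC S (of_cells Z) p sg [ffun i : 'I_m.+1 => nth (defP N) ts i] b =
  if valid_data p sg ts b then Z (string p sg) (gaps p sg ts b) else 0.
Proof.
move=> le_pm size_ts; have [vj sj gj] := mkJP sg b le_pm size_ts.
rewrite /getC -/(mkJ p sg ts b) vj; case: ifP => // v.
by rewrite ffunE vj v sj gj.
Qed.

Lemma cells_inj j1 j2 : validJ S j1 -> validJ S j2 ->
  stringJ j1 = stringJ j2 -> gapsJ j1 = gapsJ j2 -> j1 = j2.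
Proof.
case: j1 => [[[p1 sg1] t1] b1]; case: j2 => [[[p2 sg2] t2] b2].
rewrite !validJE => /and3P[/forallP sg1_0 /forallP t1_0 /and3P[_ ts1 b1B]].
move=> /and3P[/forallP sg2_0 /forallP t2_0 /and3P[_ ts2 b2B]] Es.
have Ep : p1 = p2.
  by have := congr1 size Es; rewrite !size_string => -[/val_inj].
rewrite -{p2}Ep in Es sg2_0 t2_0 ts2 b2B *; rewrite /= in sg1_0 t1_0 sg2_0 t2_0.
have Esg : sg1 = sg2.
  apply/ffunP => i; have [le_ip|lt_pi] := leqP i p1; last first.
    by rewrite (eqP (implyP (sg1_0 i) lt_pi)) (eqP (implyP (sg2_0 i) lt_pi)).
  have := congr1 (nth 0%N ^~ i) Es; rewrite !nth_string //= inord_val.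
  exact: val_inj.
rewrite -{sg2}Esg in Es sg2_0 ts2 b2B *.
move=> /gap_list_inj[Eu Ets Ev].
have Eb : b1 = b2.
  apply: (push_pair_inj (j := n)) b1B b2B _; first by rewrite val_le_n leqnn.
  by rewrite /push_pair Eu Ev.
have le_p1 : (sg1 (inord p1) <= n <= n)%N by rewrite val_le_n leqnn.
have Et := map_inj_all (push_pair_inj le_p1) ts1 ts2 Ets.
rewrite Eb; congr (_, _, _, _); apply/ffunP => i.
have [lt_i|le_i] := ltnP i (m - p1); last first.
  by rewrite (eqP (implyP (t1_0 i) le_i)) (eqP (implyP (t2_0 i) le_i)).
by have := congr1 (nth (defP N) ^~ i) Et; rewrite !nth_mkseq //= inord_val.
Qed.

(** The total m+2 counts p+1 indices and, for a tuple of m-p pairs, m-p+1 gaps. *)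
Lemma cells_surj s g : vcell n L s g -> (size s + size g)%N = m.+2 ->
  exists j, [/\ validJ S j, stringJ j = s & gapsJ j = g].
Proof.
move=> vsg size_sg; have g_n0 : g != [::] by case/and5P: vsg.
have [u [ts [v Dg]]] := gap_list_surj g_n0; rewrite {g_n0 g}Dg in vsg size_sg *.
move: vsg; rewrite vcell_gap_list => /and5P[s_n0 ss sn tsL uvL].
rewrite size_gap_list in size_sg; set p := (size s).-1.
have size_s : size s = p.+1 by rewrite prednK // lt0n size_eq0.
pose sg l : 'I_n.+1 := inord (nth 0%N s l).
have Es : string p sg = s.
  apply: (@eq_from_nth _ 0%N) => [|i]; rewrite size_string ?size_s // => lt_ip.
  rewrite nth_string // /sg /= inordK // ltnS; apply: (allP sn).
  by rewrite mem_nth // size_s.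
rewrite -Es last_string head_string in tsL uvL.
have [ts0 ts0B Ets] := push_pairs_lift (val_le_n _) tsL.
have [b bB [Eu Ev]] := push_pair_lift (val_le_n _) uvL.
have size_ts : size ts0 = (m - p)%N.
  have := size_sg; rewrite size_s -Ets size_map addSn addnS => -[] <-.
  by rewrite addKn.
have le_pm : (p <= m)%N.
  by have := size_sg; rewrite size_s addSn addnS => -[] <-; apply: leq_addr.
have [vj sj gj] := mkJP sg b le_pm size_ts; exists (mkJ p sg ts0 b); split.
- by rewrite vj /valid_data Es ss ts0B bB.
- by rewrite sj.
- by rewrite gj /gaps Ets Eu Ev.
Qed.

(** By [cells_inj] the sum has at most one term; it picks the index of the cell if there is one and
    gives 0 otherwise. *)
Definition cells_of G s g : k :=
  \sum_(j : J N n m | [&& validJ S j, stringJ j == s & gapsJ j == g]) G j.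

Lemma cells_of_supported G : supported n L (cells_of G).
Proof.
move=> s g nv; rewrite /cells_of big_pred0 // => j.
apply/negbTE; apply: contra nv => /and3P[vj /eqP <- /eqP <-].
by apply: vcell_gaps; move: vj; rewrite validJE => /and3P[].
Qed.

Lemma size_cells j : validJ S j -> (size (stringJ j) + size (gapsJ j))%N = m.+2.
Proof.
move=> _; rewrite size_string size_gap_list size_map size_mkseq.
have : (j.1.1.1 <= m)%N by rewrite -ltnS.
by lia.
Qed.

Lemma cells_of_size G s g : (size s + size g)%N != m.+2 -> cells_of G s g = 0.
Proof.
move=> sz; rewrite /cells_of big_pred0 // => j.
by apply/negbTE; apply: contra sz => /and3P[/size_cells <- /eqP <- /eqP <-].
Qed.

Lemma cells_ofE G j : validJ S j -> cells_of G (stringJ j) (gapsJ j) = G j.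
Proof.
move=> vj; rewrite /cells_of (big_pred1 j) // => i.
apply/and3P/eqP => [[vi /eqP Es /eqP Eg]|-> //]; exact: cells_inj.
Qed.

Lemma cells_of_cells Z s g : vcell n L s g -> (size s + size g)%N = m.+2 ->
  cells_of (of_cells Z) s g = Z s g.
Proof.
by move=> vsg /(cells_surj vsg)[j [vj <- <-]]; rewrite cells_ofE // ffunE vj.
Qed.

Lemma mem_Cspace G :
  G \in Cspace k n S m <-> (forall j, ~~ validJ S j -> G j = 0).
Proof. exact: mem_span_indicators. Qed.

Lemma cells_ofK G : G \in Cspace k n S m -> of_cells (cells_of G) = G.
Proof.
move=> /mem_Cspace G0; apply/ffunP => j; rewrite ffunE.
by case: ifPn => [/cells_ofE|/G0].
Qed.

Lemma of_cells_mem Z : of_cells Z \in Cspace k n S m.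
Proof. by apply/mem_Cspace => j nv; rewrite ffunE (negPf nv). Qed.

Lemma eq_of_cells Z1 Z2 :
    (forall s g, vcell n L s g -> (size s + size g)%N = m.+2 ->
       Z1 s g = Z2 s g) ->
  of_cells Z1 = of_cells Z2.
Proof.
move=> eq_Z; apply/ffunP => j; rewrite !ffunE; case: ifP => // vj.
apply: eq_Z; last exact: size_cells.
by apply: vcell_gaps; move: vj; rewrite validJE => /and3P[].
Qed.

Lemma cells_ofZD c G1 G2 s g :
  cells_of (c *: G1 + G2) s g = c * cells_of G1 s g + cells_of G2 s g.
Proof.
rewrite /cells_of mulr_sumr -big_split; apply: eq_bigr => j _.
by rewrite !ffunE.
Qed.

End Indices.
End CellsOfIndices.

(** * The faces of the total differential as deletions *)

Section TotalDifferential.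
Variables (k : fieldType) (N n : nat).
Variables (S : nat -> {set {set 'I_N}}) (f : nat -> 'I_N -> 'I_N).
Hypothesis hS : forall i, (i <= n)%N -> is_simpcomp (S i).
Hypothesis hf : forall i, (i < n)%N -> inj_simp_map (S i) (S i.+1) (f i).
Local Notation face := {set 'I_N}.
Local Notation PT := (face * face)%type.
Local Notation L := (image_cpx n S f).
Local Notation Alg := {ffun PT -> k^o}.
Implicit Types (sg : nat -> 'I_n.+1) (ts : seq PT) (b : PT) (a : nat -> Alg).
Implicit Types (Z : seq nat -> seq PT -> k) (s : seq nat) (g : seq PT).

Hint Resolve val_le_n : core.

Lemma res_evec i j u : (i <= j <= n)%N -> u \in Bas S i ->
  res S f i j (evec k (push_pair f i j u)) = evec k u.
Proof.
move=> le_ijn uB; apply/ffunP => w; rewrite !ffunE.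
have [wB|wB] := ifPn; last by case: eqP => // Ew; rewrite Ew uB in wB.
by rewrite (inj_in_eq (push_pair_inj hf le_ijn)).
Qed.

Lemma res_evec0 i j u : (forall w, w \in Bas S i -> push_pair f i j w != u) ->
  res S f i j (evec k u) = 0.
Proof.
move=> nu; apply/ffunP => w; rewrite !ffunE.
by case: ifP => // /nu/negPf; rewrite /push_pair => ->.
Qed.

Lemma amul_evec (u w : PT) :
  amul (evec k u) (evec k w) = if u.2 == w.1 then evec k (u.1, w.2) else 0.
Proof.
case: u w => [x y] [y' z] /=; apply/ffunP => -[c d]; rewrite !ffunE /=.
rewrite (bigD1 y) //= big1 => [|v /negPf nvy]; last first.
  by rewrite !ffunE xpair_eqE nvy andbF mul0r.
rewrite !ffunE !xpair_eqE eqxx andbT addr0.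
case: (y == y'); rewrite ffunE ?xpair_eqE ?mulr0 //=.
by case: eqP; case: eqP => _ _; rewrite ?mulr1 ?mulr0.
Qed.

Section Evaluation.
Variable m : nat.
Implicit Types (G : {ffun J N n m -> k^o}).

Lemma ev_evec G p sg a ts b : (p <= m)%N -> size ts = (m - p)%N ->
    (forall l, (l < m - p)%N -> a l = evec k (nth (defP N) ts l)) ->
  ev S G p sg a b = getC S G p sg [ffun i : 'I_m.+1 => nth (defP N) ts i] b.
Proof.
move=> le_pm size_ts Ea; rewrite ffunE; set t0 := [ffun i => _].
rewrite (bigD1 t0) /=; last first.
  apply/forallP => i; apply/implyP => le_i.
  by rewrite ffunE nth_default // size_ts.
rewrite big1 ?mul1r => [|i lt_i]; last by rewrite Ea // !ffunE eqxx.
rewrite big1 ?addr0 // => t /andP[/forallP t0P ne_t].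
have [i lt_i ne_i] : exists2 i : 'I_m.+1, (i < m - p)%N & t i != t0 i.
  apply/exists_inP; apply: contraR ne_t => /exists_inPn eq_t.
  apply/eqP/ffunP => i; have [/eq_t/negPn/eqP//|le_i] := ltnP i (m - p).
  by rewrite (eqP (implyP (t0P i) le_i)) ffunE nth_default // size_ts.
rewrite (bigD1 i) //= Ea // ffunE (_ : _ == _ = false) ?mul0r //.
by apply: contraNF ne_i; rewrite ffunE.
Qed.

Lemma ev_of_cells Z p sg a ts b : (p <= m)%N -> size ts = (m - p)%N ->
    (forall l, (l < m - p)%N -> a l = evec k (nth (defP N) ts l)) ->
  ev S (of_cells n S f m Z) p sg a b =
    if valid_data S p sg ts b then Z (string p sg) (gaps f p sg ts b) else 0.
Proof.
by move=> le_pm size_ts Ea; rewrite (ev_evec _ _ _ le_pm size_ts Ea)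
  getC_of_cells.
Qed.

Lemma ev_zero G p sg a b l : (p <= m)%N -> (l < m - p)%N -> a l = 0 ->
  ev S G p sg a b = 0.
Proof.
move=> le_pm lt_l al0; rewrite ffunE big1 // => t _.
have lt_lm : (l < m.+1)%N by apply: leq_trans lt_l _;
  apply: leq_trans (leq_subr _ _) _.
by rewrite (bigD1 (Ordinal lt_lm)) //= al0 ffunE !mul0r.
Qed.

End Evaluation.
Lemma string_face p sg r : (r <= p.+1)%N ->
  take r (string p.+1 sg) ++ drop r.+1 (string p.+1 sg) =
  string p (fun l => if (l < r)%N then sg l else sg l.+1).
Proof.
move=> le_rp; apply: (@eq_from_nth _ 0%N) => [|i].
  by rewrite size_cat size_takel ?size_drop ?size_string //; lia.
rewrite size_cat size_takel ?size_drop ?size_string; last exact: leqW.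
move=> lt_i; have le_ip : (i <= p)%N by lia.
rewrite (nth_string _ le_ip) nth_cat size_takel ?size_string; last exact: leqW.
case: ltnP => [lt_ir|le_ri]; first by rewrite nth_take // nth_string // ltnW.
by rewrite nth_drop addSn subnKC // nth_string.
Qed.

Section StringFaces.
Variables (m p : nat) (Z : seq nat -> seq PT -> k).
Variables (sg : nat -> 'I_n.+1) (ts : seq PT) (b : PT) (a : nat -> Alg).
Hypothesis suppZ : supported n L Z.
Hypothesis le_pm : (p <= m)%N.
Hypothesis size_ts : size ts = (m - p)%N.
Hypothesis valid : valid_data S p.+1 sg ts b.
Hypothesis aE : forall l, (l < m - p)%N -> a l = evec k (nth (defP N) ts l).

Let sgS i : (i <= p)%N -> (sg i <= sg i.+1)%N.
Proof. by case/andP: valid => /sorted_string sgP _; apply: sgP. Qed.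

Let sorted_face r : (r <= p.+1)%N ->
  sorted leq (string p (fun l => if (l < r)%N then sg l else sg l.+1)).
Proof.
move=> le_rp; case/andP: valid => ss _; rewrite -string_face //.
apply: (subseq_sorted leq_trans) ss;
  rewrite -{3}(cat_take_drop r (string p.+1 sg)).
by rewrite cat_subseq // -[r.+1]add1n -drop_drop drop_subseq.
Qed.

Lemma first_string_face :
  res S f (sg 0%N) (sg 1%N)
      (ev S (of_cells n S f m Z) p (fun l => sg l.+1) a) b =
  Z (string p (fun l => sg l.+1)) (gaps f p.+1 sg ts b).
Proof.
have /and3P[_ tsB bB] := valid; have le01 : (sg 0%N <= sg 1%N <= n)%N.
  by rewrite (sgS (leq0n p)) val_le_n.
rewrite ffunE bB (ev_of_cells _ _ _ le_pm size_ts aE).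
have -> : gaps f p (fun l => sg l.+1) ts (push_pair f (sg 0%N) (sg 1%N) b) =
          gaps f p.+1 sg ts b.
  by rewrite /gaps /= !push_comp.
rewrite ifT // /valid_data tsB (push_pair_Bas hf) // !andbT.
exact: (@sorted_face 0).
Qed.

Lemma middle_string_face r : (0 < r <= p)%N ->
  ev S (of_cells n S f m Z) p (fun l =>
    if (l < r)%N then sg l else sg l.+1) a b =
  Z (string p (fun l => if (l < r)%N then sg l else sg l.+1))
    (gaps f p.+1 sg ts b).
Proof.
move=> /andP[r_gt0 le_rp]; have /and3P[_ tsB bB] := valid.
rewrite (ev_of_cells _ _ _ le_pm size_ts aE).
have np : (p < r)%N = false by rewrite ltnNge le_rp.
by rewrite /valid_data /gaps sorted_face ?(leqW le_rp) // r_gt0 np tsB bB.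
Qed.

(** If all pairs come from the smaller complex, lifting them leaves the pushed gaps unchanged. If
    one does not, its restriction is 0 and the face is not a valid cell, so both sides vanish. *)
Lemma last_string_face :
  ev S (of_cells n S f m Z) p sg (fun l => res S f (sg p) (sg p.+1) (a l)) b =
  Z (string p sg) (gaps f p.+1 sg ts b).
Proof.
have /and3P[_ tsB bB] := valid; have le_pp : (sg p <= sg p.+1 <= n)%N.
  by rewrite (sgS (leqnn p)) val_le_n.
pose lifts t := [exists w in Bas S (sg p), push_pair f (sg p) (sg p.+1) w == t].
have [/allP all_lift|/allPn[t ts_t nlift]] := boolP (all lifts ts).
  have [ts0 ts0B Ets] : exists2 ts0, all (mem (Bas S (sg p))) ts0 &
      map (push_pair f (sg p) (sg p.+1)) ts0 = ts.
    elim: (ts) all_lift => [|t ts' IHts] lift_t; first by exists [::].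
    have [|ts0 ts0B <-] := IHts; first by move=> u u_ts;
      rewrite lift_t // inE u_ts orbT.
    have /exists_inP[w wB /eqP <-] := lift_t t (mem_head _ _).
    by exists (w :: ts0); rewrite //= [_ \in _]wB.
  have size_ts0 : size ts0 = (m - p)%N by rewrite -size_ts -Ets size_map.
  rewrite (ev_of_cells _ _ (ts := ts0)) // => [|l lt_l].
    have -> : gaps f p sg ts0 b = gaps f p.+1 sg ts b.
      rewrite /gaps -Ets -map_comp; congr gap_list; apply: eq_map => t /=.
      by rewrite push_pair_comp.
    rewrite ifT // /valid_data ts0B bB !andbT; apply/sorted_string => i lt_ip.
    exact/sgS/ltnW.
  rewrite aE // -Ets (nth_map (defP N)) ?size_ts0 // res_evec //.
  by apply: (allP ts0B); rewrite mem_nth // size_ts0.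
have lt_t : (index t ts < m - p)%N by rewrite -size_ts index_mem.
rewrite (ev_zero _ _ _ le_pm lt_t) => [|]; last first.
  rewrite aE // nth_index // res_evec0 // => w wB.
  by apply: contra nlift => Ew; apply/exists_inP; exists w.
rewrite suppZ //; apply: contra nlift; rewrite vcell_gap_list last_string.
case/and5P=> _ _ _ /allP/(_ _ (map_f _ ts_t))/= /and3P[x1L x2L _] _.
have := allP tsB _ ts_t; rewrite /= mem_Bas => /and3P[x1S x2S sub12].
have [x xS Ex] := push_lift hf le_pp x1S x1L.
have [y yS Ey] := push_lift hf le_pp x2S x2L.
apply/exists_inP; exists (x, y);
  last by rewrite /push_pair /= Ex Ey -surjective_pairing.
by rewrite mem_Bas xS yS -(push_sub hf le_pp) //= Ex Ey.
Qed.

Lemma string_faces :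
  (res S f (sg 0%N) (sg 1%N)
       (ev S (of_cells n S f m Z) p (fun l => sg l.+1) a)
   + \sum_(1 <= r < p.+1) (-1) ^+ r *:
       ev S (of_cells n S f m Z) p (fun l =>
         if (l < r)%N then sg l else sg l.+1) a
   + (-1) ^+ p.+1 *:
       ev S (of_cells n S f m Z) p sg (fun l =>
         res S f (sg p) (sg p.+1) (a l))) b =
  delta (fun=> 1) (Z^~ (gaps f p.+1 sg ts b)) (string p.+1 sg).
Proof.
rewrite (deltaE _ _ _ 0%N) size_string.
rewrite -(big_mkord xpredT (fun i => (-1) ^+ i * 1 *
  Z (take i (string p.+1 sg) ++ drop i.+1 (string p.+1 sg))
    (gaps f p.+1 sg ts b))).
rewrite [RHS]big_nat_recr // [in RHS]big_ltn //.
rewrite ffunE [in LHS]ffunE sum_ffunE; congr (_ + _ + _).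
- by rewrite expr0 !mul1r string_face //; apply: first_string_face.
- apply: eq_big_nat => r /andP[r_gt0 le_rp].
  by rewrite ffunE mulr1 string_face ?middle_string_face ?r_gt0 // ltnW.
rewrite ffunE last_string_face mulr1 string_face //; congr (_ * Z _ _).
by apply: eq_string => l le_lp; rewrite ltnS le_lp.
Qed.

End StringFaces.

Section GapFaces.
Variables (m p : nat) (Z : seq nat -> seq PT -> k).
Variables (sg : nat -> 'I_n.+1) (ts : seq PT) (b : PT) (a : nat -> Alg).
Hypothesis suppZ : supported n L Z.
Hypothesis le_pm : (p <= m)%N.
Hypothesis size_ts : size ts = (m - p).+1.
Hypothesis valid : valid_data S p sg ts b.
Hypothesis aE : forall l, (l < (m - p).+1)%N -> a l =
  evec k (nth (defP N) ts l).
Local Notation phi := (res S f (sg 0%N) (sg p)).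
Local Notation G := (of_cells n S f m Z).

Let le_0p : (sg 0%N <= sg p <= n)%N.
Proof.
case/andP: valid => ss _; rewrite val_le_n andbT.
by rewrite -(head_string p sg) -[val (sg p)](last_string p sg) head_le_last.
Qed.

Let le_pn : (sg p <= n <= n)%N.
Proof. by rewrite val_le_n leqnn. Qed.

Let le_0n : (sg 0%N <= n <= n)%N.
Proof. by rewrite val_le_n leqnn. Qed.

Let tsB l : (l < (m - p).+1)%N -> nth (defP N) ts l \in Bas S (sg p).
Proof.
case/and3P: valid => _ /allP tB _ lt_l; apply: tB.
by rewrite mem_nth // size_ts.
Qed.

(** When the first gap is diagonal, the product leaves one candidate for the intermediate face, the
    lift of [t.2] to the first complex. It exists if the remaining gaps form a cell; otherwise
    support makes both sides 0. *)
Lemma first_gap_face :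
  amul (phi (a 0%N)) (ev S G p sg (fun l => a l.+1)) b =
  diag_wt k (nth (set0, set0) (gaps f p sg ts b) 0) *
    Z (string p sg) (drop 1 (gaps f p sg ts b)).
Proof.
have /and3P[ss /allP tB bB] := valid; move: bB;
  rewrite mem_Bas => /and3P[b1S b2S _].
case Dts: ts (tsB (ltn0Sn _)) => [|t ts']; first by move: size_ts; rewrite Dts.
rewrite /= mem_Bas => /and3P[t1S t2S t12].
have evE y : ev S G p sg (fun l => a l.+1) (y, b.2) =
    if valid_data S p sg ts' (y, b.2) then Z (string p sg)
      (gaps f p sg ts' (y, b.2)) else 0.
  apply: ev_of_cells => // [|l lt_l]; first by move: size_ts;
    rewrite Dts => -[].
  by rewrite aE // Dts.
rewrite /gaps /= drop0; set G' := gap_list _ _ _.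
have gapsE y : push f (sg 0%N) (sg p) y = t.2 -> gaps f p sg ts' (y, b.2) = G'.
  by move=> Ey; rewrite /gaps /G' -Ey push_comp.
have phiE y : phi (a 0%N) (b.1, y) =
    ([&& (b.1, y) \in Bas S (sg 0%N), push f (sg 0%N) (sg p) b.1 == t.1
       & push f (sg 0%N) (sg p) y == t.2])%:R.
  by rewrite aE // Dts !ffunE /=; case: ifP.
rewrite ffunE; under eq_bigr do rewrite evE phiE.
rewrite /diag_wt /diagonal /= -(push_comp f b.1 (l := n) le_0p).
have [E1|ne1] := eqVneq (push f (sg 0%N) (sg p) b.1) t.1; last first.
  rewrite big1 => [|y _]; last by rewrite andbF mul0r.
  rewrite (inj_in_eq (push_inj hf le_pn)) ?(negPf ne1) ?mul0r //.
  exact: (push_mem hf).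
rewrite E1 eqxx mul1r; have [vG|nvG] := boolP (vcell n L (string p sg) G');
  last first.
  rewrite suppZ // big1 // => y _; have [Ey|] := eqVneq _ t.2; last first.
    by rewrite !andbF mul0r.
  by rewrite gapsE // suppZ // if_same mulr0.
move: vG; rewrite vcell_gap_list head_string =>
  /and5P[_ _ _ _ /and3P[t2L _ t2b]].
have [y0 y0S Ey0] := push_lift hf le_0p t2S t2L.
have y0b : y0 \subset b.2.
  by rewrite -(push_sub hf le_0n) // -(push_comp f y0 le_0p) Ey0.
have b1y0 : b.1 \subset y0 by rewrite -(push_sub hf le_0p) // E1 Ey0.
rewrite (bigD1 y0) //= mem_Bas /= b1S y0S b1y0 Ey0 eqxx mul1r gapsE // ifT.
  rewrite big1 ?addr0 // => y ne_y; rewrite mem_Bas /= b1S /=.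
  have [/= yS|] := boolP (y \in S (sg 0%N)); last by rewrite mul0r.
  rewrite -Ey0 (inj_in_eq (push_inj hf le_0p)) // (negPf ne_y).
  by rewrite andbF mul0r.
rewrite /valid_data ss mem_Bas /= y0S b2S y0b !andbT.
by apply/allP => u u_ts; apply: tB; rewrite Dts inE u_ts orbT.
Qed.

Lemma last_gap_face :
  amul (ev S G p sg a) (phi (a (m - p)%N)) b =
  diag_wt k (nth (set0, set0) (gaps f p sg ts b) (m - p).+1) *
    Z (string p sg) (take (m - p).+1 (gaps f p sg ts b)
                     ++ drop (m - p).+2 (gaps f p sg ts b)).
Proof.
have /and3P[ss /allP tB bB] := valid; move: bB;
  rewrite mem_Bas => /and3P[b1S b2S _].
have := tsB (ltnSn _); set t := nth _ _ _;
  rewrite mem_Bas => /and3P[t1S t2S t12].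
set ts' := take (m - p) ts.
have size_ts' : size ts' = (m - p)%N by rewrite size_takel // size_ts.
have evE y : ev S G p sg a (b.1, y) =
    if valid_data S p sg ts' (b.1, y) then Z (string p sg)
      (gaps f p sg ts' (b.1, y)) else 0.
  apply: ev_of_cells => // l lt_l.
  by rewrite aE ?nth_take // ltnW.
pose pts := map (push_pair f (sg p) n) ts.
have size_pts : (m - p).+1 = size pts by rewrite size_map size_ts.
have [En Et] := gap_list_last (set0, set0) (push f (sg 0%N) n b.1)
  (push f (sg 0%N) n b.2) size_pts.
rewrite [drop _ _]drop_oversize ?cats0; last by rewrite size_gap_list -size_pts.
rewrite {2}/gaps -/pts Et /gaps -/pts En.
rewrite /pts -map_take (nth_map (defP N)) ?size_ts // -/t -/ts' /=.
set G' := gap_list _ _ _.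
have gapsE y : push f (sg 0%N) (sg p) y = t.1 -> gaps f p sg ts' (b.1, y) = G'.
  by move=> Ey; rewrite /gaps /G' -Ey push_comp.
have phiE y : phi (a (m - p)%N) (y, b.2) =
    ([&& (y, b.2) \in Bas S (sg 0%N), push f (sg 0%N) (sg p) b.2 == t.2
       & push f (sg 0%N) (sg p) y == t.1])%:R.
  rewrite aE // -/t !ffunE /=; case: ifP => //= _.
  by case: (t) => t1 t2; rewrite xpair_eqE andbC.
rewrite ffunE; under eq_bigr do rewrite evE phiE mulrC.
rewrite /diag_wt /diagonal /= -(push_comp f b.2 (l := n) le_0p).
rewrite [push f (sg p) n t.2 == _]eq_sym.
have [E1|ne1] := eqVneq (push f (sg 0%N) (sg p) b.2) t.2; last first.
  rewrite big1 => [|y _]; last by rewrite andbF mul0r.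
  rewrite (inj_in_eq (push_inj hf le_pn)) ?(negPf ne1) ?mul0r //.
  exact: (push_mem hf).
rewrite E1 eqxx mul1r; have [vG|nvG] := boolP (vcell n L (string p sg) G');
  last first.
  rewrite suppZ // big1 // => y _; have [Ey|] := eqVneq _ t.1; last first.
    by rewrite !andbF mul0r.
  by rewrite gapsE // suppZ // if_same mulr0.
move: vG; rewrite vcell_gap_list head_string =>
  /and5P[_ _ _ _ /and3P[_ t1L b1t]].
have [y0 y0S Ey0] := push_lift hf le_0p t1S t1L.
have y0b : y0 \subset b.2 by rewrite -(push_sub hf le_0p) // E1 Ey0.
have b1y0 : b.1 \subset y0.
  by rewrite -(push_sub hf le_0n) // -(push_comp f y0 le_0p) Ey0.
rewrite (bigD1 y0) //= mem_Bas /= b2S y0S y0b Ey0 eqxx mul1r gapsE // ifT.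
  rewrite big1 ?addr0 // => y ne_y; rewrite mem_Bas /= b2S /=.
  have [/= yS|] := boolP (y \in S (sg 0%N)); last by rewrite mul0r.
  rewrite -Ey0 (inj_in_eq (push_inj hf le_0p)) // (negPf ne_y).
  by rewrite andbF mul0r.
rewrite /valid_data ss mem_Bas /= b1S y0S b1y0 !andbT.
by apply/allP => u /mem_take; apply: tB.
Qed.

Lemma middle_gap_face i : (0 < i < (m - p).+1)%N ->
  ev S G p sg (fun l => if (l < i.-1)%N then a l
                        else if l == i.-1 then amul (a i.-1) (a i)
                        else a l.+1) b =
  diag_wt k (nth (set0, set0) (gaps f p sg ts b) i) *
    Z (string p sg) (take i (gaps f p sg ts b) ++ drop i.+1 (gaps f p sg ts b)).
Proof.
case: i => // l /= lt_l; have lt_l' := ltnW lt_l.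
have lt_lts : (l.+1 < size ts)%N by rewrite size_ts.
have lt_lts' := ltnW lt_lts.
have /and3P[ss /allP tB bB] := valid.
have := tsB lt_l'; have := tsB lt_l.
set t := nth _ ts l; set t' := nth _ ts l.+1 => t'B tlB.
pose pts := map (push_pair f (sg p) n) ts.
have [En Et] := gap_list_merge (push_pair f (sg p) n (defP N)) (set0, set0)
  (push f (sg 0%N) n b.1) (push f (sg 0%N) n b.2) (ts := pts) (l :=
    l) (etrans (congr1 _ (size_map _ _)) lt_lts).
rewrite [in RHS]/gaps -/pts Et En /pts !(nth_map (defP N)) // -/t -/t' /diag_wt
  /diagonal /=.
have -> : merge_at (push_pair f (sg p) n (defP N)) l
  (map (push_pair f (sg p) n) ts) =
    map (push_pair f (sg p) n) (merge_at (defP N) l ts).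
  by rewrite /merge_at map_cat map_take /= map_drop !(nth_map (defP N)).
move: (tlB) (t'B); rewrite !mem_Bas =>
  /and3P[t1S t2S t12] /and3P[t1'S t2'S t12'].
rewrite (inj_in_eq (push_inj hf le_pn)) //.
rewrite !aE // -/t -/t' amul_evec; have [E|_] := eqVneq t.2 t'.1; last first.
  by rewrite mul0r (ev_zero _ _ _ le_pm (l := l)) ?ltnn ?eqxx.
rewrite mul1r (ev_of_cells _ _ (ts := merge_at (defP N) l ts)) //.
- rewrite ifT // /valid_data ss bB andbT /=.
  rewrite /merge_at all_cat /= mem_Bas /= t1S t2'S (subset_trans t12) ?E //
    andbT.
  by apply/andP; split; apply/allP => u; [move/mem_take/tB | move/mem_drop/tB].
- by rewrite size_merge_at // size_ts.
move=> l0 lt_l0; rewrite nth_merge_at //; case: ifP => _;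
  first by rewrite aE // ltnW.
by case: eqP => // _; rewrite aE.
Qed.

Lemma gap_faces :
  (amul (phi (a 0%N)) (ev S G p sg (fun l => a l.+1))
   + \sum_(1 <= i < (m - p).+1) (-1) ^+ i *:
       ev S G p sg (fun l => if (l < i.-1)%N then a l
                             else if l == i.-1 then amul (a i.-1) (a i)
                             else a l.+1)
   + (-1) ^+ (m - p).+1 *: amul (ev S G p sg a) (phi (a (m - p)%N))) b =
  delta (@diag_wt k _) (Z (string p sg)) (gaps f p sg ts b).
Proof.
have sz : size (gaps f p sg ts b) = (m - p).+2.
  by rewrite size_gap_list size_map size_ts.
rewrite (deltaE _ _ _ (set0, set0)) sz.
rewrite -(big_mkord xpredT (fun i => (-1) ^+ i *
  diag_wt k (nth (set0, set0) (gaps f p sg ts b) i) *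
  Z (string p sg) (take i (gaps f p sg ts b) ++ drop i.+1 (gaps f p sg ts b)))).
rewrite [RHS]big_nat_recr // [in RHS]big_ltn //.
rewrite ffunE [in LHS]ffunE sum_ffunE; congr (_ + _ + _).
- by rewrite first_gap_face expr0 mul1r take0.
- by apply: eq_big_nat => i lt_i; rewrite ffunE middle_gap_face // -mulrA.
by rewrite ffunE last_gap_face -mulrA.
Qed.

End GapFaces.


(** The deletions without counterpart in [Dtot], of the only index when p = 0 or of the only gap
    when q = 0, end in an empty list, where a supported cochain is 0. *)
Lemma Dtot_of_cells m Z : supported n L Z ->
  Dtot S f (of_cells n S f m Z) = of_cells n S f m.+1 (dcell Z).
Proof.
move=> suppZ; apply/ffunP => j; rewrite [LHS]ffunE [RHS]ffunE.
case: ifP => // vj; move: vj; rewrite validJE => /and3P[_ _].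
rewrite /dcell /gapsJ /stringJ size_string.
set sg := fun l => j.1.1.2 (inord l); set ts := tupleJ j => valid.
have aE l : (l < m.+1 - j.1.1.1)%N ->
    evec k (j.1.2 (inord l)) = evec k (nth (defP N) ts l).
  by move=> lt_l; rewrite nth_mkseq.
have size_ts : size ts = (m.+1 - j.1.1.1)%N by rewrite size_mkseq.
have le_p : (j.1.1.1 <= m.+1)%N by rewrite -ltnS.
move: (nat_of_ord j.1.1.1) le_p size_ts aE valid => p le_p size_ts aE valid.
rewrite ffunE [X in _ + X]ffunE !exprS mulrA mulN1r mulNr mulN1r opprK.
congr (_ + _ * _).
  case: p le_p size_ts aE valid => [|p] le_p size_ts aE valid.
    by rewrite ffunE /= suppZ // mulr0 subrr.
  exact: (@string_faces m p Z sg ts j.2 _ suppZ).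
case Eq: (m.+1 - p)%N => [|q].
  have -> : ts = [::] by apply: size0nil; rewrite size_ts Eq.
  by rewrite ffunE /gaps /= suppZ ?mulr0 ?subrr // /vcell andbF.
have le_pm : (p <= m)%N by lia.
have Dq : q = (m - p)%N by lia.
rewrite {q}Dq in Eq *; rewrite Eq in size_ts aE.
exact: (@gap_faces m p Z sg ts j.2 _ suppZ).
Qed.

End TotalDifferential.

(** * Comparison with ordered simplicial cochains *)

Section Comparison.
Variables (k : fieldType) (N n : nat).
Variables (S : nat -> {set {set 'I_N}}) (f : nat -> 'I_N -> 'I_N).
Hypothesis hS : forall i, (i <= n)%N -> is_simpcomp (S i).
Hypothesis hf : forall i, (i < n)%N -> inj_simp_map (S i) (S i.+1) (f i).
Local Notation face := {set 'I_N}.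
Local Notation PT := (face * face)%type.
Local Notation L := (image_cpx n S f).
Local Notation U m := {ffun J N n m -> k^o}.
Local Notation V := {ffun face -> k^o}.
Implicit Types (Z : seq nat -> seq PT -> k) (x : face) (v r : seq nat).

Let L_simpcomp := image_cpx_simpcomp f hS.
Let L_mono := image_cpx_mono (S := S) hf.

Lemma eq_ev m (G1 G2 : U m) p sg a :
  (forall j, validJ S j -> G1 j = G2 j) -> ev S G1 p sg a = ev S G2 p sg a.
Proof.
move=> eq_G; apply/ffunP => b; rewrite !ffunE; apply: eq_bigr => t _.
by congr (_ * _); rewrite /getC; case: ifP => // /eq_G.
Qed.

Lemma eq_Dtot m (G1 G2 : U m) :
  (forall j, validJ S j -> G1 j = G2 j) -> Dtot S f G1 = Dtot S f G2.
Proof.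
move=> eq_G; have Eev p sg a := @eq_ev m G1 G2 p sg a eq_G.
apply/ffunP => j; rewrite [LHS]ffunE [RHS]ffunE; case: (validJ S j) => //.
move: (nat_of_ord j.1.1.1) => p;
  apply: (congr1 (fun h : {ffun PT -> k^o} => h j.2)).
congr (_ + _); last apply: (congr1 (fun h => _ *: h)).
  case: p => // p; rewrite !Eev; congr (_ + _ + _).
  by apply: eq_bigr => i _; rewrite Eev.
case: (_ - p)%N => // q; rewrite !Eev; congr (_ + _ + _).
by apply: eq_bigr => i _; rewrite Eev.
Qed.

Lemma DtotE m (G : U m) : Dtot S f G =
  of_cells n S f m.+1 (dcell (cells_of S f G)).
Proof.
rewrite -Dtot_of_cells //; last exact: cells_of_supported.
by apply: eq_Dtot => j vj; rewrite ffunE vj cells_ofE.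
Qed.

Lemma of_cells_linear m c Z1 Z2 :
  of_cells n S f m (fun s g => c * Z1 s g + Z2 s g) =
  c *: of_cells n S f m Z1 + of_cells n S f m Z2.
Proof.
apply/ffunP => j; rewrite !ffunE; case: ifP => // _.
by rewrite scaler0 addr0.
Qed.

Lemma dcellZD (c : k) Z1 Z2 s g :
  dcell (fun s g => c * Z1 s g + Z2 s g) s g = c * dcell Z1 s g + dcell Z2 s g.
Proof. by rewrite /dcell !deltaZD; ring. Qed.

Lemma Dtot_linear m : linear (@Dtot k N n S f m).
Proof.
move=> c G1 G2; rewrite !DtotE -of_cells_linear;
  apply: eq_of_cells => // s g _ _.
rewrite -dcellZD; apply: eq_dcell => *; exact: cells_ofZD.
Qed.

Lemma cobound_linear q : linear (@cobound k N (S n) q).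
Proof.
move=> c y1 y2; apply/ffunP => x; rewrite !ffunE; case: ifP => _;
  last by rewrite scaler0 addr0.
rewrite scaler_sumr -big_split; apply: eq_bigr => i _.
by rewrite !ffunE mulrDr; congr (_ + _); apply: mulrCA.
Qed.

Lemma of_cells_cells_of_dcell m (G : U m) :
  Dtot S f G = of_cells n S f m.+1 (cut n L (dcell (cells_of S f G))).
Proof. by rewrite DtotE; apply: eq_of_cells => // s g vsg _;
  rewrite /cut vsg. Qed.

Lemma DtotK m (G : U m) : Dtot S f (Dtot S f G) = 0.
Proof.
rewrite (of_cells_cells_of_dcell G) Dtot_of_cells //; last exact: cut_supported.
apply/ffunP => j; rewrite !ffunE; case: ifP => // vj.
apply: dcell_cut_dcell => //; first exact: cells_of_supported.
by apply: vcell_gaps => //; move: vj; rewrite validJE => /and3P[].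
Qed.

Definition nerve_of_simp (y : V) : seq face -> k := last_vertex (y \o @vset N).

Definition to_simp m (G : U m) : V :=
  [ffun x => if x \in simplices (S n) m
             then sd (@vset N) (to_nerve n (cells_of S f G)) (vlist x) else 0].

Definition from_simp m (y : V) : U m :=
  of_cells n S f m (of_nerve n L (nerve_of_simp y)).

Lemma from_simp_linear m : linear (from_simp m).
Proof.
move=> c y1 y2; rewrite /from_simp -of_cells_linear.
apply: eq_of_cells => // s g _ _; rewrite /of_nerve /nerve_of_simp /last_vertex.
case: ifP => _; last by rewrite mulr0 addr0.
case: ifP => _; last by rewrite mulr0 addr0.
by rewrite /= !ffunE.
Qed.

Lemma mem_Sspace q (y : V) :
  y \in Sspace k (S n) q <-> (forall x, x \notin simplices (S n) q -> y x = 0).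
Proof. exact: mem_span_indicators. Qed.

Lemma to_simp_mem m (G : U m) : to_simp G \in Sspace k (S n) m.
Proof. by apply/mem_Sspace => x nx; rewrite ffunE (negPf nx). Qed.

Lemma cobound_mem q y : cobound (S n) q y \in Sspace k (S n) q.+1.
Proof. by apply/mem_Sspace => x nx; rewrite ffunE (negPf nx). Qed.

Lemma mem_simplices q x : (x \in simplices (S n) q) =
  (x \in S n) && (#|x| == q.+1).
Proof. by rewrite inE. Qed.

Lemma vset_mem x r : x \in S n -> subseq r (vlist x) -> r != [::] ->
  vset N r \in S n.
Proof.
move=> xS sub_r r_n0; have [_ Sdown] := hS (leqnn n); apply: Sdown xS _ _.
  by rewrite -{1}(vlistK x); apply/vsetS/mem_subseq.
have /hasP[i ri _] : has predT r by rewrite has_predT lt0n size_eq0.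
have ltiN := allP (vlist_lt x) _ (mem_subseq sub_r ri).
by apply/set0Pn; exists (Ordinal ltiN); rewrite inE.
Qed.

Lemma eq_sd_nerve m Z1 Z2 x : x \in simplices (S n) m ->
    (forall s g, vcell n L s g -> (size s + size g)%N = m.+2 ->
       Z1 s g = Z2 s g) ->
  sd (@vset N) (to_nerve n Z1) (vlist x) =
    sd (@vset N) (to_nerve n Z2) (vlist x).
Proof.
rewrite mem_simplices => /andP[xS /eqP size_x] eq_Z.
apply: (eq_sd_chain (S := S n) (X := setT)) => [r||c cc size_c].
- exact: vset_mem.
- exact: subsetT.
rewrite size_vlist size_x in size_c; apply: eq_Z.
  by rewrite vcell_top // image_cpx_top cc -size_eq0 size_c.
by rewrite /= size_map size_c.
Qed.

Lemma to_simp_Dtot m (G : U m) : to_simp (Dtot S f G) =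
  cobound (S n) m (to_simp G).
Proof.
have suppG := @cells_of_supported k N n S f hf m G.
apply/ffunP => x; have [xS|nxS] := boolP (x \in simplices (S n) m.+1);
  last first.
  by rewrite [LHS]ffunE [RHS]ffunE (negPf nxS).
rewrite coboundE // ffunE xS DtotE.
rewrite (@eq_sd_nerve m.+1 _ (dcell (cells_of S f G))) //; last first.
  by move=> s g vsg sz; rewrite cells_of_cells.
rewrite (@eq_sd _ _ _ _ _ (delta (fun=> 1) (to_nerve n (cells_of S f G)))).
  rewrite sd_delta; apply: eq_delta_face => v1 i v2 Dv _ /=.
  have sub_v : subseq (v1 ++ v2) (vlist x)
    by rewrite Dv cat_subseq // subseq_cons.
  have sv := subseq_sorted ltn_trans sub_v (vlist_sorted x).
  have ltv : all (ltn^~ N) (v1 ++ v2).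
    by apply/allP => l /(mem_subseq sub_v)/(allP (vlist_lt x)).
  have size_v : size (v1 ++ v2) = m.+1.
    move: xS; rewrite mem_simplices -size_vlist Dv !size_cat /= addnS.
    by case/andP=> _ /eqP[].
  have vS : vset N (v1 ++ v2) \in S n.
    apply: vset_mem sub_v _; last by rewrite -size_eq0 size_v.
    by move: xS; rewrite mem_simplices => /andP[].
  by rewrite ffunE mem_simplices card_vset // size_v eqxx vS vsetK.
by move=> c; rewrite (to_nerve_delta c suppG).
Qed.

Lemma nerve_of_simp_nil m y : y \in Sspace k (S n) m ->
  nerve_of_simp y [::] = 0.
Proof.
move=> /mem_Sspace y0; apply: y0; rewrite mem_simplices.
have -> : vset N [::] = set0 by apply/setP => i; rewrite !inE.
by rewrite cards0 andbF.
Qed.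

Lemma chain_of_vcell s g :
    vcell n L s g -> size s = 1%N -> all (@diagonal _) g ->
  chain (S n) setT (map fst g).
Proof.
move=> vsg sz_s dg; move: vsg; rewrite {1}(diagonalE dg) vcell_diag //.
case: s sz_s => [|i [|? ?]] //= _;
  rewrite andbT => /and3P[_ le_in /andP[sc /allP ac]].
apply/andP; split=> //; apply/allP => x /ac/andP[xL ->]; rewrite andbT.
rewrite -(image_cpx_top n S f); apply: (subsetP _ _ xL).
by apply: L_mono; rewrite le_in leqnn.
Qed.

Lemma vset_simplex c m : chain (S n) setT c -> size c = m.+1 ->
    sorted ltn (map (@maxv N) c) ->
  (vset N (map (@maxv N) c) \in simplices (S n) m)
  /\ vlist (vset N (map (@maxv N) c)) = map (@maxv N) c.
Proof.
move=> cc sz_c sc; have ltc := chain_maxv_lt (hS (leqnn n)) cc.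
rewrite vsetK // mem_simplices card_vset // size_map sz_c eqxx andbT;
  split=> //.
apply: (vset_maxv_mem (hS (leqnn n)) cc) => //.
by rewrite -size_eq0 size_map sz_c.
Qed.

Lemma Dtot_from_simp m y : y \in Sspace k (S n) m ->
  Dtot S f (from_simp m y) = from_simp m.+1 (cobound (S n) m y).
Proof.
move=> Sy; rewrite Dtot_of_cells //; last exact: of_nerve_supported.
apply: eq_of_cells => // s g vsg sz; rewrite dcell_of_nerve //;
  last exact: nerve_of_simp_nil Sy.
rewrite /of_nerve; case: ifP => // /and3P[/eqP sz_s dg _].
have cc := chain_of_vcell vsg sz_s dg.
rewrite /nerve_of_simp -last_vertex_delta; last exact: sorted_maxv cc.
rewrite /last_vertex; case: ifP => // sc.
have sz_c : size (map fst g) = m.+2 by rewrite size_map; move: sz;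
  rewrite sz_s add1n => -[].
have [vS Ev] := vset_simplex cc sz_c sc.
by rewrite /= coboundE // Ev.
Qed.

Lemma from_simpK m y : y \in Sspace k (S n) m -> to_simp (from_simp m y) = y.
Proof.
move=> /mem_Sspace y0; apply/ffunP => x; rewrite ffunE;
  case: ifPn => [xS|/y0 //].
rewrite (@eq_sd_nerve m _ (of_nerve n L (nerve_of_simp y))) //; last first.
  by move=> s g vsg sz; rewrite cells_of_cells.
rewrite -[RHS](congr1 y (vlistK x)).
rewrite -[RHS](@sd_last_vertex k N (y \o @vset N)) ?vlist_sorted ?vlist_lt //.
move: xS; rewrite mem_simplices => /andP[xS /eqP sz_x].
apply: (eq_sd_chain (S := S n) (X := setT)) => [r||c cc size_c].
- exact: vset_mem.
- exact: subsetT.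
rewrite of_nerveK // -?size_eq0 ?size_c ?size_vlist ?sz_x //.
by rewrite image_cpx_top.
Qed.

(** [W] is a function on cells of all degrees; its part one degree lower is the primitive, and in
    degree 0 [of_cells0_dcell] shows that the difference vanishes. *)
Lemma cocycle_homologous m (G : U m) : G \in Cspace k n S m -> Dtot S f G = 0 ->
  exists2 W, supported n L W &
    G - from_simp m (to_simp G) = of_cells n S f m (dcell W).
Proof.
move=> CG DG; set Z := cells_of S f G.
have suppZ : supported n L Z := @cells_of_supported k N n S f hf m G.
(* The cocycle condition speaks of total size m+3 only; at other sizes no face has size m+2, where
   alone [Z] can be nonzero. *)
have dZ0 s g : vcell n L s g -> dcell Z s g = 0.
  move=> vsg; have [sz|sz] := eqVneq (size s + size g)%N m.+3.
    have [j [vj <- <-]] := cells_surj hf vsg sz.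
    by move/ffunP/(_ j): DG; rewrite DtotE !ffunE vj.
  rewrite (@eq_dcell _ _ _ _ (fun _ _ => 0)).
  - by rewrite /dcell !delta_face0 // mulr0 addr0.
  - move=> s1 i s2 Ds; apply: cells_of_size; apply: contra sz => /eqP sz.
    by rewrite Ds; move: sz; rewrite !size_cat /=; lia.
  - move=> g1 e g2 Dg _; apply: cells_of_size; apply: contra sz => /eqP sz.
    by rewrite Dg; move: sz; rewrite !size_cat /=; lia.
have [W suppW EZ] := cocycle_of_nerve L_simpcomp L_mono suppZ dZ0.
exists W => //; apply/eqP; rewrite subr_eq; apply/eqP.
rewrite -{1}(cells_ofK hf CG) -/Z -[of_cells _ _ _ _ (dcell W)]scale1r
  -of_cells_linear.
apply: eq_of_cells => // s g vsg sz; rewrite mul1r EZ //; congr (_ + _).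
rewrite /of_nerve; case: ifP => // /and3P[/eqP sz_s dg _].
have cc := chain_of_vcell vsg sz_s dg.
rewrite /simp_retract /nerve_of_simp /last_vertex; case: ifP => // sc.
have sz_c : size (map fst g) = m.+1 by rewrite size_map; move: sz;
  rewrite sz_s add1n => -[].
have [vS Ev] := vset_simplex cc sz_c sc.
by rewrite /= ffunE vS Ev.
Qed.

(** In degree 0 a cell has one index and one gap, so every deletion empties a list. *)
Lemma of_cells0_dcell (W : seq nat -> seq PT -> k) : supported n L W ->
  of_cells n S f 0 (dcell W) = 0.
Proof.
move=> suppW; rewrite -[RHS](_ : of_cells n S f 0 (fun _ _ => 0) = 0);
  last first.
  by apply/ffunP => j; rewrite !ffunE if_same.
apply: eq_of_cells => // s g vsg sz.
have [s_gt0 g_gt0] : (0 < size s)%N /\ (0 < size g)%N.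
  by rewrite !lt0n !size_eq0; case/and3P: vsg.
have [sz_s sz_g] : size s = 1%N /\ size g = 1%N by move: sz s_gt0 g_gt0; lia.
case: s sz_s {vsg sz s_gt0} => [|i []] // _;
  case: g sz_g {g_gt0} => [|e []] // _.
by rewrite /dcell /= !suppW //= ?mulr0 ?subrr ?mulr0 ?addr0 // /vcell ?andbF.
Qed.

Lemma to_simp0 m : to_simp (0 : U m) = 0.
Proof.
apply/ffunP => x; rewrite !ffunE; case: ifP => // _.
rewrite (@eq_sd _ _ _ _ _ (fun=> 0 * 0)) ?sdZ ?mul0r // => c.
by rewrite /to_nerve /cells_of big1 // => j _; rewrite ffunE.
Qed.

Lemma from_simp0 m : from_simp m 0 = 0.
Proof. by rewrite -(linfun_linearE (@from_simp_linear m)) linear0. Qed.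

(** Inherited from [DtotK] through the split injection [from_simp]. *)
Lemma cobound_cobound m y : y \in Sspace k (S n) m ->
  cobound (S n) m.+1 (cobound (S n) m y) = 0.
Proof.
move=> Sy; rewrite -[LHS](from_simpK (cobound_mem _ _)).
by rewrite -Dtot_from_simp ?cobound_mem // -Dtot_from_simp // DtotK to_simp0.
Qed.

Let cocycles_GS q := (Cspace k n S q :&: lker (linfun (@Dtot k N n S f q)))%VS.
Let cocycles_simp q :=
  (Sspace k (S n) q :&: lker (linfun (@cobound k N (S n) q)))%VS.

Lemma mem_cocycles_GS q G :
  G \in cocycles_GS q <-> G \in Cspace k n S q /\ Dtot S f G = 0.
Proof.
rewrite memv_cap memv_ker (linfun_linearE (@Dtot_linear q)).
by split=> [/andP[-> /eqP]|[-> ->]]; rewrite ?eqxx.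
Qed.

Lemma mem_cocycles_simp q y :
  y \in cocycles_simp q <-> y \in Sspace k (S n) q /\ cobound (S n) q y = 0.
Proof.
rewrite memv_cap memv_ker (linfun_linearE (@cobound_linear q)).
by split=> [/andP[-> /eqP]|[-> ->]]; rewrite ?eqxx.
Qed.

(** The coboundary spaces are left abstract so that degree 0, where they are zero, is treated
    together with the positive degrees. *)
Lemma dim_cohom_eq q (BA : {vspace U q}) (BB : {vspace V}) :
    (BA <= cocycles_GS q)%VS -> (BB <= cocycles_simp q)%VS ->
    (forall G, G \in BA -> to_simp G \in BB) ->
    (forall y, y \in BB -> from_simp q y \in BA) ->
    (forall W, supported n L W -> of_cells n S f q (dcell W) \in BA) ->
  (\dim (cocycles_GS q) - \dim BA = \dim (cocycles_simp q) - \dim BB)%N.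
Proof.
move=> sBA sBB FB GB WB.
apply: (@dimv_quotient_eq _ _ _ _ _ _ _ (@to_simp q)
  (linfun (from_simp q))) => //.
- move=> G /mem_cocycles_GS[CG DG]; apply/mem_cocycles_simp.
  split; first exact: to_simp_mem.
  by rewrite -to_simp_Dtot DG to_simp0.
- move=> y /mem_cocycles_simp[Sy dy]; rewrite linfun_linearE;
  last exact: from_simp_linear.
  apply/mem_cocycles_GS; split; first exact: of_cells_mem.
  by rewrite Dtot_from_simp // dy from_simp0.
- by move=> y yB; rewrite linfun_linearE; [apply: GB | apply: from_simp_linear].
- move=> y /mem_cocycles_simp[Sy _]; rewrite linfun_linearE;
  last exact: from_simp_linear.
  exact: from_simpK.
move=> G /mem_cocycles_GS[CG DG]; rewrite linfun_linearE;
  last exact: from_simp_linear.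
by have [W suppW ->] := cocycle_homologous CG DG; apply: WB.
Qed.

End Comparison.

Theorem theorem5p10 (k : fieldType) (N n : nat)
  (S : nat -> {set {set 'I_N}}) (f : nat -> 'I_N -> 'I_N)
  (hS : forall i, (i <= n)%N -> is_simpcomp (S i))
  (hf : forall i, (i < n)%N -> inj_simp_map (S i) (S i.+1) (f i))
  (q : nat) :
  HH_dim k n S f q = Hsimp_dim k (S n) q.
Proof.
case: q => [|q]; rewrite /HH_dim /Hsimp_dim /cohom_dim.
  rewrite !limg0; apply: (dim_cohom_eq hS hf); rewrite ?sub0v //.
  - by move=> G; rewrite !memv0 => /eqP->; rewrite to_simp0.
  - by move=> y; rewrite !memv0 => /eqP->; rewrite (from_simp0 _ hf).
  - by move=> W /(of_cells0_dcell hf)->; rewrite mem0v.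
have linD m := linfun_linearE (@Dtot_linear k N n S f hf m).
have lind m := linfun_linearE (@cobound_linear k N n S m).
apply: (dim_cohom_eq hS hf).
- apply/subvP => _ /memv_imgP[G _ ->]; rewrite linD.
  apply/(mem_cocycles_GS hf); split; last exact: DtotK.
  by rewrite (DtotE hf) of_cells_mem.
- apply/subvP => _ /memv_imgP[y Sy ->]; rewrite lind.
  by apply/mem_cocycles_simp; rewrite cobound_mem (cobound_cobound hS hf).
- move=> _ /memv_imgP[G CG ->]; rewrite linD (to_simp_Dtot hS hf) -lind.
  exact/memv_img/to_simp_mem.
- move=> _ /memv_imgP[y Sy ->]; rewrite lind -(Dtot_from_simp hS hf) // -linD.
  exact/memv_img/of_cells_mem.
- move=> W suppW; rewrite -(Dtot_of_cells hf q suppW) -linD.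
  exact/memv_img/of_cells_mem.
Qed.
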